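(* The pseudo-process $F(|B(t)|)$, $t>0$, has measure density $$q(x,t)=2\int_0^\infty\frac{1}{\sqrt{2\pi s}}\cos\left(\frac{x^2}{2s}-\frac{\pi}{4}\right)\frac{e^{-\frac{s^2}{2t}}}{\sqrt{2\pi t}}\,ds$$ which satisfies the fourth-order heat equation $$\begin{cases}\dfrac{\partial u}{\partial t}=-\dfrac{1}{2^3}\dfrac{\partial^4u}{\partial x^4}, & x\in\mathbb{R},\ t>0,\\ u(x,0)=\delta(x).\end{cases}$$
   Context: $B(t)$, $t>0$, is a standard Brownian motion started at $0$. $F(t)$, $t>0$, is the Fresnel pseudo-process, independent of $B$: its one-dimensional law is the signed measure $$\mu\{F(t)\in dx\}=\frac{dx}{\sqrt{2\pi t}}\cos\left(\frac{x^2}{2t}-\frac{\pi}{4}\right),\qquad x\in\mathbb{R}.$$ The measure density of the composition $F(|B(t)|)$ is by definition obtained by integrating the density of $F(s)$ against the law of $|B(t)|$, i.e. it is the function $q(x,t)$. $\delta$ is the Dirac delta and the initial condition is in the sense of distributions as $t\to0^+$. *)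

(* Defs.v *)
From HB Require Import structures.
From mathcomp Require Import all_boot all_order all_algebra.
From mathcomp Require Import all_classical all_reals all_analysis.

Set Implicit Arguments.
Unset Strict Implicit.
Unset Printing Implicit Defensive.

Import Order.TTheory GRing.Theory Num.Theory.
Import numFieldNormedType.Exports.

Local Open Scope classical_set_scope.
Local Open Scope ring_scope.

Section brownian_motion.
Context d (T : measurableType d) (R : realType) (P : probability T R).

(* Taking some A i to be setT gives the product rule for every subfamily. *)
Definition mutually_independent (n : nat) (X : 'I_n -> T -> R) : Prop :=
  forall A : 'I_n -> set R, (forall i, measurable (A i)) ->
    P (\bigcap_(i in [set: 'I_n]) (X i @^-1` A i)) =
    (\prod_(i < n) P (X i @^-1` A i))%E.

(* Only the times t >= 0 are constrained. The second parameter of normal_prob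
   is the standard deviation. *)
Record standard_brownian_motion (B : R -> {RV P >-> R}) : Prop := {
  bm_start : {ae P, forall w, B 0 w = 0} ;
  bm_gaussian_increments : forall s t : R, 0 <= s -> s < t ->
    forall A : set R, measurable A ->
      pushforward P (B t \- B s) A = normal_prob 0 (Num.sqrt (t - s)) A ;
  bm_independent_increments : forall (n : nat) (tau : nat -> R),
    0 <= tau 0%N -> (forall i, tau i <= tau i.+1) ->
    mutually_independent
      (fun i : 'I_n => B (tau i.+1) \- B (tau i)) ;
  bm_continuous_paths :
    {ae P, forall w, {within `[0, +oo[, continuous (fun t : R => B t w)}} }.

End brownian_motion.

Section fresnel.
Context (R : realType).

(* Density at x, for s > 0, of the signed one-dimensional law of the Fresnel
   pseudo-process at time s. *)
Definition fresnel_density (s x : R) : R :=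
  (Num.sqrt (2 * pi * s))^-1 * cos (x ^+ 2 / (2 * s) - pi / 4).

Definition abs_law d (T : measurableType d) (P : probability T R)
    (B : R -> {RV P >-> R}) (t : R) : set R -> \bar R :=
  pushforward P (fun w => `|B t w|).

(* u(., t) is the measure density of F(|B(t)|): the density of F(s) integrated
   against the law of |B(t)|. A pseudo-process has no underlying probability
   space, so the independence of F and B is expressed by the fact that the
   density of F(s) is integrated against the unconditional law of |B(t)|. *)
Definition has_composition_density d (T : measurableType d)
    (P : probability T R) (B : R -> {RV P >-> R}) (u : R -> R -> R) : Prop :=
  forall x t : R, 0 < t ->
    (abs_law B t).-integrable `]0, +oo[
      (fun s : R => (fresnel_density s x)%:E) /\
    (\int[abs_law B t]_(s in `]0%R, +oo[)
      (fresnel_density s x)%:E = (u x t)%:E)%E.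

Definition q (x t : R) : R :=
  2 * \int[lebesgue_measure]_(s in `]0, +oo[)
        ((Num.sqrt (2 * pi * s))^-1 * cos (x ^+ 2 / (2 * s) - pi / 4)
         * (expR (- (s ^+ 2 / (2 * t))) / Num.sqrt (2 * pi * t))).

Definition fourth_order_heat_eq (u : R -> R -> R) : Prop :=
  forall x t : R, 0 < t ->
    [/\ derivable (fun r : R => u x r) t 1,
        forall k, (k < 4)%N ->
          derivable (derive1n k (fun y : R => u y t)) x 1
      & derive1 (fun r : R => u x r) t =
        - (1 / 2 ^+ 3) * derive1n 4 (fun y : R => u y t) x].

Definition test_function (phi : R -> R) : Prop :=
  (forall (n : nat) (x : R), derivable (derive1n n phi) x 1) /\
  compact (closure [set x : R | phi x != 0]).

(* u(., t), as a distribution on R, tends to the Dirac mass at 0. *)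
Definition initial_dirac (u : R -> R -> R) : Prop :=
  (forall t : R, 0 < t -> locally_integrable [set: R] (fun x : R => u x t)) /\
  (forall phi : R -> R, test_function phi ->
    (\int[lebesgue_measure]_x (u x t * phi x)) @[t --> (0 : R)^'+]
      --> phi 0).

End fresnel.

(* Main.v *)
From HB Require Import structures.
Require Import Defs.
From mathcomp Require Import all_boot all_order all_algebra.
From mathcomp Require Import all_classical all_reals all_analysis.
From mathcomp Require Import measurable_realfun ring lra.

(** Why the theorem holds.  The Fresnel law at time [s] has Fourier transform
    [cos (s y^2 / 2)], and averaging this over [s = |B(t)|] evaluates the
    characteristic function of a centred normal variable of variance [t] at
    [y^2 / 2], which is [exp (- t y^4 / 8)] (lemma [gauss_density_transform]).
    So [q] should be the inverse Fourier transform

      [q x t = 1 / (2 pi) * \int cos (x y) exp (- t y^4 / 8) dy],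

    and this is lemma [q_fourier], from which all the rest is deduced.

    The two integrations, in [s] and in [y], cannot be exchanged as they stand,
    since the double integral does not converge absolutely.  A factor
    [exp (- e y^2 / 2)] is inserted.  The integral in [y] then becomes a Gaussian
    integral with the complex parameter [e - i s].  Its real and imaginary parts
    solve linear differential equations in [x] and in [s], which gives its closed
    form ([gauss_chirpE]).  As [e] tends to [0] this closed form tends to
    [2 pi] times the Fresnel density ([gauss_chirp_cvg]) while it remains below
    [sqrt (2 pi / |s|)] ([gauss_chirp_bound]).  That bound is integrable against
    the Gaussian weight, because of the Fatou lemma applied to the regularised
    identity at [x = 0] ([integrable_inv_sqrt_density]), and dominated convergence
    concludes.

    Density of the composition: the law of [B t] is normal, so an integral over
    the half-line against the law of [|B t|] is twice the integral against the
    Gaussian density ([ge0_integral_abs_law]).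

    Heat equation: under the integral sign [d/dt] multiplies the integrand by
    [- y^4 / 8] and [d^4/dx^4] multiplies it by [y^4] ([is_derive_moment_t],
    [is_derive_moment_x]).

    Initial condition: with [g x = exp (- x^2 / 2)], a test function is
    [phi 0 * g + phi' 0 * x g + r], where [r] is bounded by a multiple of
    [x^2 / (1 + x^2)] ([gauss_remainder_bound]).  The pairing of [q] with [g] is
    explicit and tends to [1] ([cvg_integral_q_gauss]), the pairing with the odd
    function [x g] is zero, and the pairing with [r] tends to [0]: two
    integrations by parts bound [x^2 |q x t|] by the L1 norm of the second
    derivative of [exp (- t y^4 / 8)] ([q_sqr_bound]), which tends to [0] with
    [t] ([cvg_integral_symbol_dd]). *)
Set Implicit Arguments.
Unset Strict Implicit.
Unset Printing Implicit Defensive.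

Import Order.TTheory GRing.Theory Num.Theory.
Import numFieldNormedType.Exports.

Local Open Scope classical_set_scope.
Local Open Scope ring_scope.

(** * Derivatives computed from the shape of the function *)

Section derivation_rules.
Context {R : realType}.
Implicit Types (f g : R -> R) (x : R).

Lemma is_derive_fun_cst (c x : R) : is_derive x 1 (fun=> c) 0.
Proof. exact: is_derive_cst. Qed.

Lemma is_derive_fun_id x : is_derive x 1 (fun y => y) 1.
Proof. exact: is_derive_id. Qed.

Lemma is_derive_fun_add f g x a b : is_derive x 1 f a -> is_derive x 1 g b ->
  is_derive x 1 (fun y => f y + g y) (a + b).
Proof. by move=> fa gb; exact: is_deriveD. Qed.

Lemma is_derive_fun_opp f x a : is_derive x 1 f a ->
  is_derive x 1 (fun y => - f y) (- a).
Proof. by move=> fa; exact: is_deriveN. Qed.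

Lemma is_derive_fun_mul f g x a b : is_derive x 1 f a -> is_derive x 1 g b ->
  is_derive x 1 (fun y => f y * g y) (a * g x + f x * b).
Proof.
move=> fa gb; apply: (is_derive_eq (is_deriveM fa gb)).
by rewrite /GRing.scale/=; ring.
Qed.

Lemma is_derive_fun_exp f x a n : is_derive x 1 f a ->
  is_derive x 1 (fun y => f y ^+ n) (n%:R * f x ^+ n.-1 * a).
Proof.
move=> fa; case: n => [|n].
  rewrite /= mul0r mul0r.
  under eq_fun do rewrite expr0.
  exact: is_derive_cst.
elim: n => [|n ih].
  under eq_fun do rewrite expr1.
  by rewrite /= expr0 mul1r mul1r.
under eq_fun do rewrite exprS.
apply: (is_derive_eq (is_derive_fun_mul fa ih)).
by rewrite /= -!natr1 exprS; ring.
Qed.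

Lemma is_derive_fun_inv f x a : f x != 0 -> is_derive x 1 f a ->
  is_derive x 1 (fun y => (f y)^-1) (- a / f x ^+ 2).
Proof.
move=> fx0 [fa <-]; apply: DeriveDef; first exact: derivableV.
by rewrite deriveV// /GRing.scale/= mulNr mulrC -mulNr.
Qed.

Lemma is_derive_fun_comp g f x a b : is_derive x 1 f a ->
  is_derive (f x) 1 g b -> is_derive x 1 (fun y => g (f y)) (b * a).
Proof.
by move=> fa gb; apply: (is_derive_eq (is_derive1_comp gb fa)); rewrite mulrC.
Qed.

Lemma is_derive_fun_expR f x a : is_derive x 1 f a ->
  is_derive x 1 (fun y => expR (f y)) (expR (f x) * a).
Proof. by move=> fa; apply: (is_derive_fun_comp fa); exact: is_derive_expR. Qed.

Lemma is_derive_fun_cos f x a : is_derive x 1 f a ->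
  is_derive x 1 (fun y => cos (f y)) (- sin (f x) * a).
Proof. by move=> fa; apply: (is_derive_fun_comp fa); exact: is_derive_cos. Qed.

Lemma is_derive_fun_sin f x a : is_derive x 1 f a ->
  is_derive x 1 (fun y => sin (f y)) (cos (f x) * a).
Proof. by move=> fa; apply: (is_derive_fun_comp fa); exact: is_derive_sin. Qed.

Lemma is_derive_fun_ln f x a : 0 < f x -> is_derive x 1 f a ->
  is_derive x 1 (fun y => ln (f y)) ((f x)^-1 * a).
Proof. by move=> fx fa; apply: (is_derive_fun_comp fa); exact: is_derive1_ln. Qed.

Lemma is_derive_fun_atan f x a : is_derive x 1 f a ->
  is_derive x 1 (fun y => atan (f y)) ((1 + f x ^+ 2)^-1 * a).
Proof. by move=> fa; apply: (is_derive_fun_comp fa); exact: is_derive1_atan. Qed.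

Lemma is_derive_cong f x a b : is_derive x 1 f a -> a = b ->
  is_derive x 1 f b.
Proof. by move=> + <-. Qed.

Lemma is_derive_continuous f df : (forall x, is_derive x 1 f (df x)) ->
  continuous f.
Proof.
by move=> fdf x; apply: differentiable_continuous; apply/derivable1_diffP;
  have [] := fdf x.
Qed.

Lemma is_derive_zero_cst f : (forall x, is_derive x 1 f 0) ->
  forall x, f x = f 0.
Proof. by move=> f0 x; apply: is_derive_0_is_cst. Qed.

End derivation_rules.

(** The rules are applied with [notypeclasses refine] because [is_derive] is a
    class: ordinary [apply] would let instance resolution choose another,
    unsimplified, form of the derivative.  The last three cases catch sections
    that unification has eta-contracted. *)
Ltac derive_rules := repeat lazymatch goal with
  | |- is_derive _ _ (fun=> ?c) _ => notypeclasses refine (is_derive_fun_cst _ _)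
  | |- is_derive _ _ (fun y => y) _ => notypeclasses refine (is_derive_fun_id _)
  | |- is_derive _ _ (fun y => @?f y + @?g y)%R _ =>
      notypeclasses refine (is_derive_fun_add _ _)
  | |- is_derive _ _ (fun y => - @?f y)%R _ =>
      notypeclasses refine (is_derive_fun_opp _)
  | |- is_derive _ _ (fun y => @?f y * @?g y)%R _ =>
      notypeclasses refine (is_derive_fun_mul _ _)
  | |- is_derive _ _ (fun y => @?f y ^+ _)%R _ =>
      notypeclasses refine (is_derive_fun_exp _ _)
  | |- is_derive _ _ (fun y => (@?f y)^-1)%R _ =>
      notypeclasses refine (is_derive_fun_inv _ _)
  | |- is_derive _ _ (fun y => expR (@?f y)) _ =>
      notypeclasses refine (is_derive_fun_expR _)
  | |- is_derive _ _ (fun y => cos (@?f y)) _ =>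
      notypeclasses refine (is_derive_fun_cos _)
  | |- is_derive _ _ (fun y => sin (@?f y)) _ =>
      notypeclasses refine (is_derive_fun_sin _)
  | |- is_derive _ _ (fun y => ln (@?f y)) _ =>
      notypeclasses refine (is_derive_fun_ln _ _)
  | |- is_derive _ _ (fun y => atan (@?f y)) _ =>
      notypeclasses refine (is_derive_fun_atan _)
  | |- is_derive _ _ (GRing.mul ?c) _ =>
      notypeclasses refine (is_derive_fun_mul (f := fun=> c) _ (is_derive_fun_id _))
  | |- is_derive _ _ (GRing.add ?c) _ =>
      notypeclasses refine (is_derive_fun_add (f := fun=> c) _ (is_derive_fun_id _))
  | |- is_derive _ _ GRing.opp _ =>
      notypeclasses refine (is_derive_fun_opp (is_derive_fun_id _))
  end.

(** The derivative found by the rules is compared with the expected one in the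
    goal that is left. *)
Ltac derive :=
  notypeclasses refine (is_derive_cong _ _); [derive_rules; eauto|].

Lemma ex_is_derive_continuous {R : realType} (f : R -> R) :
  (forall x : R, exists d, is_derive x 1 f d) -> continuous f.
Proof. by move=> /choice[d]; exact: is_derive_continuous. Qed.

Ltac smooth :=
  apply: ex_is_derive_continuous => ?; eexists; derive_rules.

(** * Integration over the real line *)

Notation integrableT f :=
  (lebesgue_measure.-integrable [set: _] (EFin \o f)).
Notation integralT f := (Rintegral lebesgue_measure [set: _] f).

Section real_line_integrals.
Context {R : realType}.
Notation mu := (@lebesgue_measure R).
Implicit Types (f g : R -> R).

Lemma integrable_dominated f g : measurable_fun setT f -> integrableT g ->
  (forall x, `|f x| <= g x) -> integrableT f.
Proof.
move=> mf ig fg; apply: (le_integrable measurableT _ _ ig) => /=.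
  exact/measurable_EFinP.
move=> x _; rewrite lee_fin; apply: (le_trans (fg x)); exact: ler_norm.
Qed.

Lemma integrable_mulrl c f : integrableT f -> integrableT (fun x => c * f x).
Proof.
move=> fi; rewrite (_ : _ \o _ = (fun x => (c%:E * (EFin \o f) x)%E)).
  exact: integrableZl.
by apply/funext => x /=; rewrite EFinM.
Qed.

Lemma integrable_addr f g : integrableT f -> integrableT g ->
  integrableT (fun x => f x + g x).
Proof.
move=> fi gi; rewrite (_ : _ \o _ = ((EFin \o f) \+ (EFin \o g))%E).
  exact: integrableD.
by apply/funext => x /=; rewrite EFinD.
Qed.

Lemma integrable_measurable f : integrableT f -> measurable_fun setT f.
Proof. by move=> /integrableP[/measurable_EFinP]. Qed.

(** A single point does not matter for the Lebesgue measure; the origin is the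
    singularity of the Fresnel density seen as a function of time. *)
Lemma ae_neq0 (P : R -> Prop) : (forall x, x != 0 -> P x) ->
  {ae mu, forall x, P x}.
Proof.
move=> P0; exists [set 0]; split => //; first exact: lebesgue_measure_set1.
by move=> x /=; apply: contra_notP => /eqP; exact: P0.
Qed.

Lemma dominated_cvg_integral (f_ : nat -> R -> R) f g :
  (forall n, measurable_fun setT (f_ n)) -> measurable_fun setT f ->
  integrableT g ->
  (forall x, x != 0 -> f_ ^~ x @ \oo --> f x) ->
  (forall n x, x != 0 -> `|f_ n x| <= g x) ->
  integralT (f_ n) @[n --> \oo] --> integralT f.
Proof.
move=> mf_ mf ig cf bf.
have H1 n : measurable_fun setT (fun x => (f_ n x)%:E).
  exact/measurable_EFinP.
have H2 : measurable_fun setT (fun x => (f x)%:E) by exact/measurable_EFinP.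
have H3 : {ae mu, forall x, setT x -> (f_ n x)%:E @[n --> \oo] --> (f x)%:E}.
  apply: ae_neq0 => x x0 _.
  by apply: cvg_EFin; [exact: nearW|exact: cf].
have H4 : {ae mu, forall x n, setT x -> (`|(f_ n x)%:E| <= (EFin \o g) x)%E}.
  by apply: ae_neq0 => x x0 n _; rewrite /= lee_fin; exact: bf.
have [intf _ +] :=
  @dominated_convergence _ _ _ mu _ measurableT _ _ _ H1 H2 H3 ig H4.
move=> H; apply: fine_cvg.
by rewrite /Rintegral fineK//; exact: integrable_fin_num.
Qed.

Lemma is_derive_integralT (f f' : R -> R -> R) (G : R -> R) (a u v : R) :
  u < a < v ->
  (forall x, u < x < v -> integrableT (f x)) ->
  (forall x y, u < x < v -> is_derive x 1 (f ^~ y) (f' x y)) ->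
  integrableT G ->
  (forall x y, u < x < v -> `|f' x y| <= G y) ->
  is_derive a 1 (fun x => integralT (f x)) (integralT (f' a)).
Proof.
move=> uav intf df iG fG.
have Ia : `]u, v[%classic a by rewrite /= in_itv.
have d1 x y : u < x < v -> partial1of2 f x y = f' x y.
  by move=> uxv; rewrite partial1of2E; have [_ ->] := df x y uxv.
have H1 x : `]u, v[%classic x -> mu.-integrable setT (EFin \o f x).
  by rewrite /= in_itv; exact: intf.
have H2 x y : `]u, v[%classic x -> [set: R] y -> derivable (f ^~ y) x 1.
  by rewrite /= in_itv => uxv _; have [] := df x y uxv.
have H3 y : 0 <= G y by exact: le_trans (fG a y uav).
have H4 x y : `]u, v[%classic x -> [set: R] y -> `|partial1of2 f x y| <= G y.
  by rewrite /= in_itv => /= uxv _; rewrite d1// fG.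
apply: DeriveDef.
  exact: (derivable_under_integral measurableT Ia H1 H2 H3 iG H4).
rewrite -derive1E (differentiation_under_integral measurableT Ia H1 H2 H3 iG H4).
by apply: eq_Rintegral => y _; rewrite d1.
Qed.

(** All integrations by parts below are instances of this: both boundary terms
    vanish, so the integral of a derivative over the whole line is zero. *)
Lemma integral_derivative_eq0 (F f : R -> R) :
  (forall x : R, is_derive x 1 F (f x)) -> continuous f -> integrableT f ->
  F n%:R @[n --> \oo] --> 0 -> F (- n%:R) @[n --> \oo] --> 0 ->
  integralT f = 0.
Proof.
move=> dF cf fi Fy FNy.
(* dominated convergence reduces to the segments [-n, n] *)
pose f_ (n : nat) := f \_ `[- n%:R, n%:R].
have H : integralT (f_ n) @[n --> \oo] --> integralT f.
  apply: (@dominated_cvg_integral _ _ (fun x => `|f x|)).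
  - move=> n; apply/(measurable_restrictT _ _).1 => //.
    by apply: measurable_funTS; exact: integrable_measurable.
  - exact: integrable_measurable.
  - exact: integrable_norm.
  - move=> x _; apply: cvg_near_cst; near=> n.
    rewrite /f_ patchE mem_set//= in_itv/= -ler_norml.
    by near: n; exact: nbhs_infty_ger.
  - by move=> n x _; rewrite /f_ patchE; case: ifPn => // _; rewrite normr0.
have E n : integralT (f_ n.+1) = F n.+1%:R - F (- n.+1%:R).
  rewrite /f_ -Rintegral_mkcond /Rintegral (@continuous_FTC2 _ f F)//=.
  - have : 0 < n.+1%:R :> R by rewrite ltr0n. lra.
  - exact: continuous_subspaceT.
  - split => [x _||]; first by have [] := dF x.
    + by apply: cvg_at_right_filter; exact: (is_derive_continuous dF).
    + by apply: cvg_at_left_filter; exact: (is_derive_continuous dF).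
  - by move=> x _; rewrite derive1E; have [_ ->] := dF x.
have K : integralT (f_ n.+1) @[n --> \oo] --> (0 - 0 : R).
  under eq_fun do rewrite E.
  by apply: cvgB; [rewrite (cvg_shiftS (fun n => F n%:R))|
    rewrite (cvg_shiftS (fun n => F (- n%:R)))].
move: H; rewrite -cvg_shiftS => /cvg_lim <-//.
by rewrite (cvg_lim _ K)// subr0.
Unshelve. all: end_near. Qed.

(** A product bound is the simplest certificate of absolute convergence, and
    it makes every section integrable, so that the real-valued iterated
    integrals agree with the extended ones. *)
Lemma fubini_dominated (h : R -> R -> R) (a b : R -> R) :
  measurable_fun [set: R * R] (fun z => h z.1 z.2) ->
  integrableT a -> integrableT b ->
  (forall x y, `|h x y| <= a x * b y) ->
  integralT (fun x => integralT (fun y => h x y)) =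
  integralT (fun y => integralT (fun x => h x y)).
Proof.
move=> mh ia ib hab.
have mhx x : measurable_fun setT (h x).
  by have := measurableT_comp mh (@pair1_measurable _ _ R R x).
have mhy y : measurable_fun setT (h ^~ y).
  by have := measurableT_comp mh (@pair2_measurable _ _ R R y).
have ihx x : integrableT (h x).
  exact: (integrable_dominated (mhx x) (integrable_mulrl (a x) ib)).
have ihy y : integrableT (h ^~ y).
  apply: (integrable_dominated (mhy y) (integrable_mulrl (b y) ia)) => x.
  by rewrite mulrC.
have Ea x : (`|a x|%:E * \int[mu]_y `|b y|%:E)%E =
            (\int[mu]_y (`|a x| * `|b y|)%:E)%E.
  under [RHS]eq_integral do rewrite EFinM.
  rewrite ge0_integralZl//.
  apply/measurable_EFinP; apply: measurableT_comp => //.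
  exact: integrable_measurable.
have mF : measurable_fun setT (fubini_F mu
    (fun z : measurableTypeR R * measurableTypeR R => `|(h z.1 z.2)%:E|%E)).
  apply: measurable_fun_fubini_tonelli_F => //.
  by apply: measurableT_comp => //; exact/measurable_EFinP.
have maI : measurable_fun (T := measurableTypeR R) setT
    (fun x => (`|a x|%:E * \int[mu]_y `|b y|%:E)%E).
  apply: emeasurable_funM; last exact: measurable_cst.
  apply/measurable_EFinP; apply: measurableT_comp => //.
  exact: integrable_measurable.
have mabs x : measurable_fun (T := measurableTypeR R) setT
    (fun y => `|h x y|%:E).
  by apply/measurable_EFinP; apply: measurableT_comp => //; exact: mhx.
have mab x : measurable_fun (T := measurableTypeR R) setT
    (fun y => (`|a x| * `|b y|)%:E).
  apply/measurable_EFinP; apply: measurable_funM => //.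
  by apply: measurableT_comp => //; exact: integrable_measurable.
have hle x : (\int[mu]_y `|h x y|%:E <= `|a x|%:E * \int[mu]_y `|b y|%:E)%E.
  rewrite Ea; apply: (@ge0_le_integral _ _ _ mu _ measurableT _ _ _ _ (mab x)) => //.
  move=> y _; rewrite lee_fin -normrM.
  exact: (le_trans (hab x y) (ler_norm _)).
have ih : (mu \x mu)%E.-integrable [set: R * R]
    (fun z => (h z.1 z.2)%:E).
  apply/integrable12ltyP; first exact/measurable_EFinP.
  apply: (@le_lt_trans _ _ (\int[mu]_x (`|a x|%:E * \int[mu]_y `|b y|%:E))%E).
    apply: (@ge0_le_integral _ _ _ mu _ measurableT _ _ _ mF maI) => // x _.
      exact: integral_ge0.
    exact: hle.
  have /integrableP[_ /= lb] := ib; have /integrableP[_ /= la] := ia.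
  rewrite ge0_integralZr//=.
  - apply: lte_mul_pinfty => //; first exact: integral_ge0.
    by rewrite ge0_fin_numE//; exact: integral_ge0.
  - apply/measurable_EFinP; apply: measurableT_comp => //.
    exact: integrable_measurable.
  - exact: integral_ge0.
have := Fubini ih; rewrite /= => H.
rewrite /Rintegral; congr fine.
transitivity (\int[mu]_x \int[mu]_y (h x y)%:E)%E.
  apply: eq_integral => x _; rewrite fineK//.
  by apply: integrable_fin_num => //; exact: ihx.
rewrite H; apply: eq_integral => y _; rewrite fineK//.
by apply: integrable_fin_num => //; exact: ihy.
Qed.

Lemma ge0_integral_reflection (g : R -> \bar R) :
  measurable_fun setT g -> (forall x, 0 <= g x)%E ->
  (\int[mu]_x g (- x)%R = \int[mu]_x g x)%E.
Proof.
move=> mg g0.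
transitivity (\int[pushforward mu (-%R : R -> measurableTypeR R)]_y g y)%E.
  by rewrite ge0_integral_pushforward//; exact: oppr_measurable.
by apply: eq_measure_integral => A mA _; exact: lebesgue_measureN.
Qed.

Lemma integrable_reflection f : integrableT f ->
  integrableT (fun x => f (- x)).
Proof.
move=> fi; have mf := integrable_measurable fi.
apply/integrableP; split.
  apply/measurable_EFinP; apply: (measurableT_comp mf).
  exact: oppr_measurable.
have /integrableP[_] := fi.
rewrite -(@ge0_integral_reflection (fun x => `|(f x)%:E|%E))//.
by apply: measurableT_comp => //; exact/measurable_EFinP.
Qed.

Lemma integral_reflection f : integrableT f ->
  integralT (fun x => f (- x)) = integralT f.
Proof.
move=> fi; rewrite /Rintegral; congr fine; rewrite integralE [RHS]integralE.
have mf : measurable_fun (T := measurableTypeR R) setT (EFin \o f).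
  exact: measurable_int fi.
rewrite -(@ge0_integral_reflection (fun x => (fun x => (f x)%:E)^\+%E x)); last 2 first.
- exact: measurable_funepos mf.
- by move=> x; exact: funepos_ge0.
rewrite -(@ge0_integral_reflection (fun x => (fun x => (f x)%:E)^\-%E x)); last 2 first.
- exact: measurable_funeneg mf.
- by move=> x; exact: funeneg_ge0.
by congr (_ - _)%E; apply: eq_integral => x _; rewrite ?(funeposE, funenegE).
Qed.

End real_line_integrals.

(** * Functions with Gaussian decay *)

Section gaussian_decay.
Context {R : realType}.
Notation mu := (@lebesgue_measure R).
Implicit Types (f g F : R -> R).

Lemma gauss_normal_pdf (c : R) : 0 < c ->
  (fun x : R => expR (- (c * x ^+ 2))) =
  (fun x => Num.sqrt (pi / c) * normal_pdf 0 (Num.sqrt ((2 * c)^-1)) x).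
Proof.
move=> c0; have c20 : 0 < (2 * c)^-1 by rewrite invr_gt0 mulr_gt0.
apply/funext => x; rewrite normal_pdfE ?gt_eqF ?sqrtr_gt0//.
rewrite /normal_peak /normal_fun sqr_sqrtr ?ltW// subr0.
have -> : (2 * c)^-1 * pi *+ 2 = pi / c.
  by rewrite -mulr_natl; field; rewrite gt_eqF.
rewrite [RHS]mulrA mulfV ?mul1r; last first.
  by rewrite gt_eqF// sqrtr_gt0 divr_gt0// pi_gt0.
congr expR; rewrite -mulr_natl; field; rewrite ?gt_eqF//.
Qed.

Lemma integrable_gauss (c : R) : 0 < c ->
  integrableT (fun x : R => expR (- (c * x ^+ 2))).
Proof.
move=> c0; rewrite gauss_normal_pdf//; apply: integrable_mulrl.
exact: integrable_normal_pdf.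
Qed.

Lemma integral_gauss (c : R) : 0 < c ->
  integralT (fun x : R => expR (- (c * x ^+ 2))) = Num.sqrt (pi / c).
Proof.
move=> c0; rewrite gauss_normal_pdf// RintegralZl//; last first.
  exact: integrable_normal_pdf.
by rewrite /Rintegral integral_normal_pdf mulr1.
Qed.

(** A class of integrands stable by sums, by multiplication by a polynomial and
    by multiplication by a bounded function, so that integrability and
    vanishing boundary terms can be read off the shape of the integrand. *)
Definition gaussian_decay f := exists K c : R,
  0 < c /\ forall y, `|f y| <= K * expR (- (c * y ^+ 2)).

Lemma gaussian_decay_mul f g M : (forall y, `|g y| <= M) ->
  gaussian_decay f -> gaussian_decay (fun y => f y * g y).
Proof.
move=> gM [K [c [c0 fK]]]; exists (K * M), c; split=> // y.
by rewrite normrM mulrAC ler_pM.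
Qed.

Lemma gaussian_decay_add f g :
  gaussian_decay f -> gaussian_decay g -> gaussian_decay (fun y => f y + g y).
Proof.
move=> [K [c [c0 fK]]] [L [d [d0 gL]]].
have K0 : 0 <= K.
  by have := le_trans (normr_ge0 _) (fK 0); rewrite pmulr_lge0// expR_gt0.
have L0 : 0 <= L.
  by have := le_trans (normr_ge0 _) (gL 0); rewrite pmulr_lge0// expR_gt0.
exists (K + L), (Num.min c d); split; first by rewrite lt_min c0.
move=> y; rewrite mulrDl (le_trans (ler_normD _ _))// lerD//.
  apply: (le_trans (fK y)); rewrite ler_wpM2l// ler_expR lerN2.
  by rewrite ler_wpM2r ?sqr_ge0// ge_min lexx.
apply: (le_trans (gL y)); rewrite ler_wpM2l// ler_expR lerN2.
by rewrite ler_wpM2r ?sqr_ge0// ge_min lexx orbT.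
Qed.

Lemma gaussian_decay_scale a f :
  gaussian_decay f -> gaussian_decay (fun y => a * f y).
Proof.
move=> [K [c [c0 fK]]]; exists (`|a| * K), c; split=> // y.
by rewrite normrM -mulrA ler_wpM2l.
Qed.

(** Half of the exponent absorbs the factor:
    [|y| <= (1 + 2 / c) exp (c y^2 / 2)]. *)
Lemma gaussian_decay_mulX f :
  gaussian_decay f -> gaussian_decay (fun y => y * f y).
Proof.
move=> [K [c [c0 fK]]].
have K0 : 0 <= K.
  by have := le_trans (normr_ge0 _) (fK 0); rewrite pmulr_lge0// expR_gt0.
exists (K * (1 + 2 / c)), (c / 2); split; first by rewrite divr_gt0.
move=> y; have yE : `|y| <= (1 + 2 / c) * expR (c / 2 * y ^+ 2).
  have H : 1 + c / 2 * y ^+ 2 <= expR (c / 2 * y ^+ 2) by exact: expR_ge1Dx.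
  apply: (@le_trans _ _ ((1 + 2 / c) * (1 + c / 2 * y ^+ 2))); last first.
    by rewrite ler_wpM2l// addr_ge0// divr_ge0// ltW.
  have -> : (1 + 2 / c) * (1 + c / 2 * y ^+ 2) =
      1 + y ^+ 2 + (2 / c + c / 2 * y ^+ 2) by field; rewrite gt_eqF.
  rewrite -[leLHS]addr0 lerD//.
    rewrite -(real_normK (num_real y)).
    by have := sqr_ge0 (`|y| - 1); have := sqr_ge0 `|y|; lra.
  apply: addr_ge0; first by rewrite divr_ge0 ?(ltW c0).
  by rewrite mulr_ge0 ?sqr_ge0 ?divr_ge0 ?(ltW c0).
rewrite normrM; apply: (le_trans (ler_pM _ _ yE (fK y))) => //.
rewrite [X in _ <= X](_ : _ =
  (1 + 2 / c) * (K * expR (- (c / 2 * y ^+ 2)))); last by ring.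
rewrite -[leLHS]mulrA ler_wpM2l ?addr_ge0 ?divr_ge0 ?(ltW c0)//.
rewrite mulrCA -expRD.
by have -> : c / 2 * y ^+ 2 + - (c * y ^+ 2) = - (c / 2 * y ^+ 2) by field.
Qed.

Lemma gaussian_decay_mulXn n f :
  gaussian_decay f -> gaussian_decay (fun y => y ^+ n * f y).
Proof.
move=> df; elim: n => [|n ih].
  by rewrite (_ : (fun=> _) = f)//; apply/funext => y; rewrite expr0 mul1r.
rewrite (_ : (fun y => _) = (fun y => y * (y ^+ n * f y))).
  exact: gaussian_decay_mulX.
by apply/funext => y; rewrite exprS mulrA.
Qed.

Lemma gaussian_decay_norm f :
  gaussian_decay f -> gaussian_decay (fun y => `|f y|).
Proof.
by move=> [K [c [c0 fK]]]; exists K, c; split=> // y; rewrite normr_id.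
Qed.

Lemma gaussian_decay_gauss (c : R) : 0 < c ->
  gaussian_decay (fun y => expR (- (c * y ^+ 2))).
Proof. by move=> c0; exists 1, c; split=> // y; rewrite mul1r ger0_norm ?expR_ge0. Qed.

(** [y^4 >= y^2 - 1], because [(y^2 - 1)^2 + y^2 >= 0]. *)
Lemma gaussian_decay_quartic (c : R) : 0 < c ->
  gaussian_decay (fun y => expR (- (c * y ^+ 4))).
Proof.
move=> c0; exists (expR c), c; split=> // y.
rewrite ger0_norm ?expR_ge0// -expRD ler_expR.
have : 0 <= c * ((y ^+ 2 - 1) ^+ 2 + y ^+ 2).
  by rewrite mulr_ge0 ?addr_ge0 ?sqr_ge0// ltW.
have -> : y ^+ 4 = (y ^+ 2) ^+ 2 by rewrite -exprM.
by set z := y ^+ 2; lra.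
Qed.

Lemma gaussian_decay_integrable f : measurable_fun setT f ->
  gaussian_decay f -> integrableT f.
Proof.
move=> mf [K [c [c0 fK]]].
apply: (integrable_dominated mf _ fK).
exact: (integrable_mulrl K (integrable_gauss c0)).
Qed.

(** [y * f y] is bounded, hence [f y] is at most a constant over [|y|]. *)
Lemma gaussian_decay_cvg f : gaussian_decay f ->
  f n%:R @[n --> \oo] --> 0 /\ f (- n%:R) @[n --> \oo] --> 0.
Proof.
move=> /gaussian_decay_mulX[K [c [c0 fK]]].
have K0 : 0 <= K.
  by have := le_trans (normr_ge0 _) (fK 0); rewrite pmulr_lge0// expR_gt0.
have bnd y : y != 0 -> `|f y| <= K * `|y|^-1.
  move=> y0; rewrite ler_pdivlMr ?normr_gt0// mulrC -normrM.
  apply: (le_trans (fK y)); rewrite ler_piMr// -expR0 ler_expR oppr_le0.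
  by rewrite mulr_ge0 ?sqr_ge0// ltW.
have lim : K * (n.+1%:R)^-1 @[n --> \oo] --> (0 : R).
  by rewrite -[X in _ --> X](mulr0 K); apply: cvgM; [exact: cvg_cst|exact: cvg_harmonic].
have limN : - (K * (n.+1%:R)^-1) @[n --> \oo] --> (0 : R).
  by rewrite -[X in _ --> X]oppr0; exact: cvgN.
have sq (u : nat -> R) : (forall n, `|u n.+1| <= K * n.+1%:R^-1) ->
    u n @[n --> \oo] --> 0.
  move=> uK; rewrite -cvg_shiftS.
  apply: (squeeze_cvgr _ limN lim); apply: nearW => n.
  by have := uK n; rewrite ler_norml.
split; apply: sq => n.
  by have := bnd n.+1%:R; rewrite pnatr_eq0 normr_nat; apply.
by have := bnd (- n.+1%:R); rewrite oppr_eq0 pnatr_eq0 normrN normr_nat; apply.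
Qed.

Lemma integral_derivative_gauss (F f : R -> R) :
  (forall x : R, is_derive x 1 F (f x)) -> continuous f ->
  gaussian_decay F -> gaussian_decay f -> integralT f = 0.
Proof.
move=> dF cf gF gf; have [F1 F2] := gaussian_decay_cvg gF.
apply: integral_derivative_eq0 dF (cf) _ F1 F2.
exact: gaussian_decay_integrable (continuous_measurable_fun cf) gf.
Qed.

End gaussian_decay.

(** * The Gaussian integral with a complex parameter *)

Section complex_gaussian.
Context {R : realType}.
Implicit Types (x y s t : R).

(** In complex form the system is [(u + i v)' = (p + i w) (u + i v)], so that
    [(u + i v) exp (- (P + i W))] is constant. *)
Lemma rotation_ode (u v p w P W : R -> R) :
  (forall t, is_derive t 1 u (p t * u t - w t * v t)) ->
  (forall t, is_derive t 1 v (w t * u t + p t * v t)) ->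
  (forall t, is_derive t 1 P (p t)) -> (forall t, is_derive t 1 W (w t)) ->
  P 0 = 0 -> W 0 = 0 ->
  forall t, u t = expR (P t) * (u 0 * cos (W t) - v 0 * sin (W t)) /\
            v t = expR (P t) * (u 0 * sin (W t) + v 0 * cos (W t)).
Proof.
move=> du dv dP dW P0 W0 t.
have da r : expR (- P r) * (u r * cos (W r) + v r * sin (W r)) = u 0.
  have H (z : R) : is_derive z 1
      (fun r => expR (- P r) * (u r * cos (W r) + v r * sin (W r))) 0.
    by derive => /=; ring.
  by rewrite (is_derive_zero_cst H) P0 W0 oppr0 expR0 cos0 sin0; ring.
have db r : expR (- P r) * (v r * cos (W r) - u r * sin (W r)) = v 0.
  have H (z : R) : is_derive z 1
      (fun r => expR (- P r) * (v r * cos (W r) - u r * sin (W r))) 0.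
    by derive => /=; ring.
  by rewrite (is_derive_zero_cst H) P0 W0 oppr0 expR0 cos0 sin0; ring.
have cs := cos2Dsin2 (W t).
have eN := expRxMexpNx_1 (P t).
rewrite -(da t) -(db t); split.
  transitivity (expR (P t) * expR (- P t) * (cos (W t) ^+ 2 + sin (W t) ^+ 2) * u t).
    by rewrite eN cs !mul1r.
  by ring.
transitivity (expR (P t) * expR (- P t) * (cos (W t) ^+ 2 + sin (W t) ^+ 2) * v t).
  by rewrite eN cs !mul1r.
by ring.
Qed.

Variable e : R.
Hypothesis e0 : 0 < e.

Let w y := expR (- (e / 2 * y ^+ 2)).

(** With [a = e - i s], this is the real part of
    [exp (i h) * \int exp (- a y^2 / 2) cos (x y) dy].  The phase [h] gives the
    real part of the Gaussian integral for [h = 0] and its imaginary part for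
    [h = - pi / 2], and differentiating in [y] amounts to shifting [h]. *)
Definition gauss_chirp x s h :=
  integralT (fun y => w y * (cos (x * y) * cos (s / 2 * y ^+ 2 + h))).

Definition gauss_chirp_dx x s h :=
  integralT (fun y => y * w y * - (sin (x * y) * cos (s / 2 * y ^+ 2 + h))).

Definition gauss_chirp_ds s h :=
  integralT (fun y => y ^+ 2 * w y * - (sin (s / 2 * y ^+ 2 + h) / 2)).

Let gw : gaussian_decay w.
Proof. by apply: gaussian_decay_gauss; rewrite divr_gt0. Qed.

Let gyw : gaussian_decay (fun y => y * w y).
Proof. exact: gaussian_decay_mulX. Qed.

Let gy2w : gaussian_decay (fun y => y ^+ 2 * w y).
Proof. exact: gaussian_decay_mulXn. Qed.

Let int_mul (f g : R -> R) : gaussian_decay f -> continuous f ->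
  (forall y, `|g y| <= 1) -> continuous g -> integrableT (fun y => f y * g y).
Proof.
move=> gf cf g1 cg; apply: gaussian_decay_integrable.
  by apply: measurable_funM; exact: continuous_measurable_fun.
exact: gaussian_decay_mul gf.
Qed.

Let norm_mul_le1 (a b : R) : `|a| <= 1 -> `|b| <= 1 -> `|a * b| <= 1.
Proof. by move=> a1 b1; rewrite normrM mulr_ile1. Qed.

Let cw : continuous w. Proof. by rewrite /w; smooth. Qed.

Let cyw : continuous (fun y => y * w y). Proof. by rewrite /w; smooth. Qed.

Let cy2w : continuous (fun y => y ^+ 2 * w y). Proof. by rewrite /w; smooth. Qed.

Let int_chirp x s h : integrableT
  (fun y => w y * (cos (x * y) * cos (s / 2 * y ^+ 2 + h))).
Proof.
apply: int_mul => //; last by smooth.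
by move=> y; rewrite norm_mul_le1// cos_max.
Qed.

Let int_chirp_dx x s h : integrableT
  (fun y => y * w y * - (sin (x * y) * cos (s / 2 * y ^+ 2 + h))).
Proof.
apply: int_mul => //; last by smooth.
by move=> y; rewrite normrN norm_mul_le1// ?cos_max ?sin_max.
Qed.

Let int_chirp_ds s h : integrableT
  (fun y => y ^+ 2 * w y * - (sin (s / 2 * y ^+ 2 + h) / 2)).
Proof.
apply: int_mul => //; last by smooth.
move=> y; rewrite normrN norm_mul_le1 ?sin_max// ger0_norm ?invr_ge0//; lra.
Qed.

Lemma is_derive_gauss_chirp_x x s h :
  is_derive x 1 (fun z => gauss_chirp z s h) (gauss_chirp_dx x s h).
Proof.
apply: (@is_derive_integralT R
  (fun x y => w y * (cos (x * y) * cos (s / 2 * y ^+ 2 + h)))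
  (fun x y => y * w y * - (sin (x * y) * cos (s / 2 * y ^+ 2 + h)))
  (fun y => `|y * w y|) x (x - 1) (x + 1)).
- lra.
- by move=> z _; exact: int_chirp.
- by move=> z y _; derive => /=; ring.
- apply: gaussian_decay_integrable; last exact: gaussian_decay_norm.
  by apply: measurableT_comp => //; exact: continuous_measurable_fun.
- move=> z y _; rewrite normrM ler_piMr//.
  by rewrite normrN norm_mul_le1 ?cos_max ?sin_max.
Qed.

Lemma is_derive_gauss_chirp_s s h :
  is_derive s 1 (fun z => gauss_chirp 0 z h) (gauss_chirp_ds s h).
Proof.
apply: (@is_derive_integralT R
  (fun s y => w y * (cos (0 * y) * cos (s / 2 * y ^+ 2 + h)))
  (fun s y => y ^+ 2 * w y * - (sin (s / 2 * y ^+ 2 + h) / 2))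
  (fun y => `|y ^+ 2 * w y|) s (s - 1) (s + 1)).
- lra.
- by move=> z _; exact: int_chirp.
- by move=> z y _; derive => /=; rewrite (mul0r y) cos0; field.
- apply: gaussian_decay_integrable; last exact: gaussian_decay_norm.
  by apply: measurableT_comp => //; exact: continuous_measurable_fun.
- move=> z y _; rewrite normrM ler_piMr//.
  rewrite normrN norm_mul_le1 ?sin_max// ger0_norm ?invr_ge0//; lra.
Qed.

Lemma gauss_chirp_dx_subpi x s h :
  gauss_chirp_dx x s (h - pi) = - gauss_chirp_dx x s h.
Proof.
rewrite /gauss_chirp_dx -[RHS]mulN1r -RintegralZl//.
apply: eq_Rintegral => y _; rewrite addrA cosB cospi sinpi; ring.
Qed.

Lemma gauss_chirp_ds_subpi s h :
  gauss_chirp_ds s (h - pi) = - gauss_chirp_ds s h.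
Proof.
rewrite /gauss_chirp_ds -[RHS]mulN1r -RintegralZl//.
by apply: eq_Rintegral => y _; rewrite addrA sinB cospi sinpi; field.
Qed.

Let integral_lincomb (f g h : R -> R) a b c : integrableT f -> integrableT g ->
  integrableT h -> integralT (fun y => a * f y + b * g y + c * h y) =
  a * integralT f + b * integralT g + c * integralT h.
Proof.
move=> fi gi hi; have af := integrable_mulrl a fi.
have bg := integrable_mulrl b gi; have ch := integrable_mulrl c hi.
rewrite RintegralD//; last exact: integrable_addr.
by rewrite RintegralD// !RintegralZl.
Qed.

(** Integrate the derivative of
    [exp (- e y^2 / 2) sin (x y) cos (s y^2 / 2 + h)]. *)
Lemma gauss_chirp_by_parts_x x s h :
  e * gauss_chirp_dx x s h + s * gauss_chirp_dx x s (h - pi / 2) +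
  x * gauss_chirp x s h = 0.
Proof.
rewrite -integral_lincomb; [|exact: int_chirp_dx..|exact: int_chirp].
apply: (@integral_derivative_gauss R
  (fun y => w y * (sin (x * y) * cos (s / 2 * y ^+ 2 + h)))).
- move=> y; rewrite /w; derive => /=.
  by rewrite addrA (cosB _ (pi / 2)) cos_pihalf sin_pihalf; field.
- by rewrite /w; smooth.
- apply: (gaussian_decay_mul (M := 1)) gw => y.
  by rewrite norm_mul_le1 ?cos_max ?sin_max.
- apply: gaussian_decay_add; [apply: gaussian_decay_add|];
    apply: gaussian_decay_scale.
  + apply: (gaussian_decay_mul (M := 1)) gyw => y.
    by rewrite normrN norm_mul_le1 ?cos_max ?sin_max.
  + apply: (gaussian_decay_mul (M := 1)) gyw => y.
    by rewrite normrN norm_mul_le1 ?cos_max ?sin_max.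
  + apply: (gaussian_decay_mul (M := 1)) gw => y.
    by rewrite norm_mul_le1 ?cos_max.
Qed.

(** Integrate the derivative of
    [y exp (- e y^2 / 2) cos (s y^2 / 2 + h)]. *)
Lemma gauss_chirp_by_parts_s s h :
  2 * s * gauss_chirp_ds s h + - (2 * e) * gauss_chirp_ds s (h - pi / 2) +
  1 * gauss_chirp 0 s h = 0.
Proof.
rewrite -integral_lincomb; [|exact: int_chirp_ds..|exact: int_chirp].
have half (a : R) : `|a| <= 1 -> `|- (a / 2)| <= 1.
  move=> a1; rewrite normrN norm_mul_le1// ger0_norm ?invr_ge0//; lra.
apply: (@integral_derivative_gauss R
  (fun y => y * w y * cos (s / 2 * y ^+ 2 + h))).
- move=> y; rewrite /w; derive => /=.
  by rewrite addrA (sinB _ (pi / 2)) cos_pihalf sin_pihalf (mul0r y) cos0; field.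
- by rewrite /w; smooth.
- apply: (gaussian_decay_mul (M := 1)) gyw => y; exact: cos_max.
- apply: gaussian_decay_add; [apply: gaussian_decay_add|];
    apply: gaussian_decay_scale.
  + by apply: (gaussian_decay_mul (M := 1)) gy2w => y; rewrite half ?sin_max.
  + by apply: (gaussian_decay_mul (M := 1)) gy2w => y; rewrite half ?sin_max.
  + apply: (gaussian_decay_mul (M := 1)) gw => y.
    by rewrite norm_mul_le1 ?cos_max.
Qed.

Let zero_lincomb (a b x y l r : R) : x = 0 -> y = 0 ->
  l - r = a * x + b * y -> l = r.
Proof. by move=> -> ->; rewrite !mulr0 addr0 => /eqP; rewrite subr_eq0 => /eqP. Qed.

(** At [x = 0], integration by parts gives the equation [dG/ds = (i / (2 a)) G]
    with [a = e - i s]; its solution is a multiple of [a^(-1/2)], whose modulus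
    and argument are the two factors below.  The constant is the real Gaussian
    integral at [s = 0]. *)
Lemma gauss_chirp0E s :
  gauss_chirp 0 s 0 = Num.sqrt (2 * pi / e) *
    expR (- (ln (1 + (s / e) ^+ 2) / 4)) * cos (atan (s / e) / 2) /\
  gauss_chirp 0 s (- (pi / 2)) = Num.sqrt (2 * pi / e) *
    expR (- (ln (1 + (s / e) ^+ 2) / 4)) * sin (atan (s / e) / 2).
Proof.
have N0 t : 0 < 1 + (t / e) ^+ 2 by rewrite ltr_pwDl ?sqr_ge0.
have eN t : e ^+ 2 + t ^+ 2 != 0 :> R.
  by rewrite gt_eqF// ltr_pwDl ?sqr_ge0 ?exprn_gt0.
have en0 : e != 0 by rewrite gt_eqF.
pose p t := - t / (2 * (e ^+ 2 + t ^+ 2)).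
pose v t := e / (2 * (e ^+ 2 + t ^+ 2)).
have dsE t : gauss_chirp_ds t 0 =
    p t * gauss_chirp 0 t 0 - v t * gauss_chirp 0 t (- (pi / 2)) /\
  gauss_chirp_ds t (- (pi / 2)) =
    v t * gauss_chirp 0 t 0 + p t * gauss_chirp 0 t (- (pi / 2)).
  have := gauss_chirp_by_parts_s t 0; have := gauss_chirp_by_parts_s t (- (pi / 2)).
  have -> : - (pi / 2) - pi / 2 = 0 - pi :> R by field.
  rewrite gauss_chirp_ds_subpi sub0r.
  set a := gauss_chirp_ds t 0; set b := gauss_chirp_ds t _.
  set c := gauss_chirp 0 t 0; set d := gauss_chirp 0 t _ => E1 E2.
  have Ha : 2 * (e ^+ 2 + t ^+ 2) * a = - t * c - e * d.
    by apply: (zero_lincomb (a := t) (b := e) E2 E1); ring.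
  have Hb : 2 * (e ^+ 2 + t ^+ 2) * b = e * c - t * d.
    by apply: (zero_lincomb (a := - e) (b := t) E2 E1); ring.
  split; apply: (mulfI (x := 2 * (e ^+ 2 + t ^+ 2))); rewrite ?mulf_neq0//.
    by rewrite Ha /p /v; field.
  by rewrite Hb /p /v; field.
have [||||||E1 E2] := @rotation_ode (fun t => gauss_chirp 0 t 0)
  (fun t => gauss_chirp 0 t (- (pi / 2))) p v
  (fun t => - (ln (1 + (t / e) ^+ 2) / 4)) (fun t => atan (t / e) / 2) _ _ _ _ _ _ s.
- by move=> t; rewrite -(dsE t).1; exact: is_derive_gauss_chirp_s.
- by move=> t; rewrite -(dsE t).2; exact: is_derive_gauss_chirp_s.
- move=> t; derive => //=; rewrite /p; field.
  by rewrite en0 eN.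
- move=> t; derive => //=; rewrite /v; field.
  by rewrite en0 eN.
- by rewrite mul0r expr0n addr0 ln1 mul0r oppr0.
- by rewrite mul0r atan0 mul0r.
rewrite E1 E2.
have -> : gauss_chirp 0 0 0 = Num.sqrt (2 * pi / e).
  rewrite (_ : 2 * pi / e = pi / (e / 2)); last by field.
  rewrite -integral_gauss ?divr_gt0//; apply: eq_Rintegral => y _.
  by rewrite !mul0r addr0 cos0 !mulr1.
have -> : gauss_chirp 0 0 (- (pi / 2)) = 0.
  rewrite -[RHS](mul0r (integralT w)) -RintegralZl//; last first.
    by apply: gaussian_decay_integrable => //; exact: continuous_measurable_fun.
  apply: eq_Rintegral => y _.
  by rewrite !mul0r add0r cosN cos_pihalf !mulr0.
by split; ring.
Qed.

(** Integration by parts gives [dG/dx = - (x / a) G] with [a = e - i s], hence a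
    factor [exp (- x^2 / (2 a))]; the value at [x = 0] is known. *)
Lemma gauss_chirpE x s : gauss_chirp x s 0 =
  Num.sqrt (2 * pi / e) * expR (- (ln (1 + (s / e) ^+ 2) / 4)) *
  expR (- (x ^+ 2 * e / (2 * (e ^+ 2 + s ^+ 2)))) *
  cos (atan (s / e) / 2 - x ^+ 2 * s / (2 * (e ^+ 2 + s ^+ 2))).
Proof.
have eN : e ^+ 2 + s ^+ 2 != 0 :> R.
  by rewrite gt_eqF// ltr_pwDl ?sqr_ge0 ?exprn_gt0.
pose p x := - x * e / (e ^+ 2 + s ^+ 2).
pose v x := - x * s / (e ^+ 2 + s ^+ 2).
have dxE t : gauss_chirp_dx t s 0 =
    p t * gauss_chirp t s 0 - v t * gauss_chirp t s (- (pi / 2)) /\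
  gauss_chirp_dx t s (- (pi / 2)) =
    v t * gauss_chirp t s 0 + p t * gauss_chirp t s (- (pi / 2)).
  have := gauss_chirp_by_parts_x t s 0; have := gauss_chirp_by_parts_x t s (- (pi / 2)).
  have -> : - (pi / 2) - pi / 2 = 0 - pi :> R by field.
  rewrite gauss_chirp_dx_subpi sub0r.
  set a := gauss_chirp_dx t s 0; set b := gauss_chirp_dx t s _.
  set c := gauss_chirp t s 0; set d := gauss_chirp t s _ => E1 E2.
  have Ha : (e ^+ 2 + s ^+ 2) * a = - t * (e * c - s * d).
    by apply: (zero_lincomb (a := e) (b := - s) E2 E1); ring.
  have Hb : (e ^+ 2 + s ^+ 2) * b = - t * (s * c + e * d).
    by apply: (zero_lincomb (a := s) (b := e) E2 E1); ring.
  split; apply: (mulfI (x := e ^+ 2 + s ^+ 2)); rewrite ?mulf_neq0//.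
    by rewrite Ha /p /v; field.
  by rewrite Hb /p /v; field.
have [||||||E1 _] := @rotation_ode (fun t => gauss_chirp t s 0)
  (fun t => gauss_chirp t s (- (pi / 2))) p v
  (fun t => - (t ^+ 2 * e / (2 * (e ^+ 2 + s ^+ 2))))
  (fun t => - (t ^+ 2 * s / (2 * (e ^+ 2 + s ^+ 2)))) _ _ _ _ _ _ x.
- by move=> t; rewrite -(dxE t).1; exact: is_derive_gauss_chirp_x.
- by move=> t; rewrite -(dxE t).2; exact: is_derive_gauss_chirp_x.
- by move=> t; derive => //=; rewrite /p; field.
- by move=> t; derive => //=; rewrite /v; field.
- by rewrite expr0n !mul0r oppr0.
- by rewrite expr0n !mul0r oppr0.
have [C S] := gauss_chirp0E s.
by rewrite E1 C S cosB cosN sinN; ring.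
Qed.

End complex_gaussian.

(** * Functions that are regular away from the origin *)

Section punctured_line.
Context {R : realType}.
Notation mu := (@lebesgue_measure R).
Implicit Types (f g : R -> R).

Lemma measurable_continuous_neq0 f :
  (forall x, x != 0 -> {for x, continuous f}) -> measurable_fun setT f.
Proof.
move=> cf; have -> : [set: R] = ~` [set 0] `|` [set 0] by rewrite setUC setUv.
have m0 : measurable [set (0 : R)] by [].

apply/measurable_funU; [exact: measurableC|exact: m0|split].
  apply: open_continuous_measurable_fun.
    apply: closed_openC; apply: accessible_closed_set1.
    by apply: hausdorff_accessible; exact: norm_hausdorff.
  by move=> x /set_mem/eqP; exact: cf.
exact: measurable_fun_set1.
Qed.

(** In a field with [0^-1 = 0] the inverse is discontinuous only at the origin. *)
Lemma measurable_invr : measurable_fun setT (fun x : R => x^-1).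
Proof.
by apply: measurable_continuous_neq0 => x x0; apply: cvgV => //; exact: cvg_id.
Qed.

Lemma eq_integral_neq0 f g : measurable_fun setT f -> measurable_fun setT g ->
  (forall x, x != 0 -> f x = g x) -> integralT f = integralT g.
Proof.
move=> mf mg fg; congr fine; apply: ae_eq_integral => //.
- exact/measurable_EFinP.
- exact/measurable_EFinP.
- by apply: ae_neq0 => x x0 _; rewrite fg.
Qed.

(** Outside the origin [f] is the sum of its restriction to the positive
    half-line and of the reflection of that restriction. *)
Lemma integral_even f : integrableT f -> (forall x, f (- x) = f x) ->
  integralT f = 2 * \int[mu]_(x in `]0, +oo[) f x.
Proof.
move=> fi fN; pose h := f \_ `]0, +oo[.
have hi : integrableT h.
  apply: (integrable_dominated _ (integrable_norm fi)) => [|x].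
    apply/(measurable_restrictT _ _).1 => //.
    by apply: measurable_funTS; exact: integrable_measurable.
  by rewrite /h patchE/=; case: ifPn => // _; rewrite normr0.
have hNi : integrableT (fun x => h (- x)).
  exact: integrable_reflection.
rewrite [in RHS]Rintegral_mkcond -/h mulr_natl mulr2n.
rewrite -[X in _ = X + _](integral_reflection hi) addrC.
rewrite -RintegralD//; apply: eq_integral_neq0.
- exact: integrable_measurable.
- by apply: integrable_measurable; exact: integrable_addr.
- move=> x x0; rewrite /h !patchE !mem_setE !in_itv/= !andbT oppr_gt0 fN.
  by case: ltgtP x0 => // _ _; rewrite ?addr0 ?add0r.
Qed.

Lemma fatou_integrable (f_ : nat -> R -> R) f M :
  (forall n, integrableT (f_ n)) -> (forall n x, 0 <= f_ n x) ->
  measurable_fun setT f -> (forall x, 0 <= f x) ->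
  (forall x, x != 0 -> f_ ^~ x @ \oo --> f x) ->
  (forall n, integralT (f_ n) <= M) -> integrableT f.
Proof.
move=> fi f_ge0 mf f0 cf fM; apply/integrableP; split; first exact/measurable_EFinP.
have mf_ n : measurable_fun (T := measurableTypeR R) setT (fun x => (f_ n x)%:E).
  exact: measurable_int (fi n).
have H := @fatou _ _ _ mu _ measurableT _ mf_ (fun n x _ => f_ge0 n x).
apply: (@le_lt_trans _ _ M%:E); last exact: ltry.
apply: le_trans (le_trans H _).
  rewrite le_eqVlt; apply/orP; left; apply/eqP.
  apply: ae_eq_integral => //.
  - by apply: measurableT_comp => //; exact/measurable_EFinP.
  - under eq_fun do rewrite limn_einf_lim.
    apply: (emeasurable_fun_cvg (fun n x => einfs (fun k => (f_ k x)%:E) n)).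
      by move=> n; exact: measurable_fun_einfs.
    by move=> x _; exact: is_cvg_einfs.
  - apply: ae_neq0 => x x0 _ /=.
    have c : (f_ n x)%:E @[n --> \oo] --> (f x)%:E.
      by apply: cvg_EFin; [exact: nearW|exact: cf].
    rewrite is_cvg_limn_einfE; last by apply/cvg_ex; exists (f x)%:E.
    by rewrite (cvg_lim _ c)// ger0_norm.
rewrite limn_einf_lim.
apply: lime_le.
  exact: is_cvg_einfs.
apply: nearW => n; apply: (@le_trans _ _ (\int[mu]_x (f_ n x)%:E)%E).
  by apply: ereal_inf_lbound; exists n => /=.
have := fM n; rewrite -lee_fin /Rintegral fineK//.
by apply: integrable_fin_num => //; exact: fi.
Qed.

End punctured_line.

(** * The regularised double integral *)

Section fourier_representation.
Context {R : realType}.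
Notation mu := (@lebesgue_measure R).
Implicit Types (x y s t e : R).

Lemma expR_ln_quarter z : 0 < z :> R -> expR (- (ln z / 4)) = (Num.sqrt (Num.sqrt z))^-1.
Proof.
move=> z0; rewrite expRN; congr (_^-1).
have zE : z = (expR (ln z / 4) ^+ 2) ^+ 2.
  rewrite -exprM -expRM_natl -[LHS]lnK ?posrE//; congr expR.
  by rewrite natrM; field.
by rewrite [in RHS]zE sqrtr_sqr ger0_norm ?exprn_ge0 ?expR_ge0// sqrtr_sqr
  ger0_norm ?expR_ge0.
Qed.

(** The common modulus, [sqrt (2 pi / |e - i s|)]. *)
Lemma gauss_chirp_amplitude e s : 0 < e ->
  Num.sqrt (2 * pi / e) * expR (- (ln (1 + (s / e) ^+ 2) / 4)) =
  Num.sqrt (2 * pi / Num.sqrt (e ^+ 2 + s ^+ 2)).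
Proof.
move=> e0; have N0 : 0 < e ^+ 2 + s ^+ 2 by rewrite ltr_pwDl ?sqr_ge0 ?exprn_gt0.
have pi2 : 0 <= 2 * pi :> R by rewrite mulr_ge0 ?pi_ge0.
have en0 : e != 0 by rewrite gt_eqF.
have -> : 1 + (s / e) ^+ 2 = (e ^+ 2 + s ^+ 2) / e ^+ 2 by field.
rewrite expR_ln_quarter ?divr_gt0 ?exprn_gt0// (sqrtrM _ (ltW N0)) sqrtrV ?sqr_ge0//.
rewrite sqrtr_sqr ger0_norm ?ltW// !sqrtrM ?sqrtr_ge0// !sqrtrV ?sqrtr_ge0 ?ltW//.
field; rewrite ?gt_eqF ?sqrtr_gt0//.
Qed.

Lemma gauss_chirp_even e x s : gauss_chirp e x (- s) 0 = gauss_chirp e x s 0.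
Proof.
apply: eq_Rintegral => y _; rewrite !addr0.
by congr (_ * (_ * _)); rewrite -[RHS]cosN; congr cos; ring.
Qed.

Lemma gauss_chirp_bound e x s : 0 < e -> s != 0 ->
  `|gauss_chirp e x s 0| <= Num.sqrt (2 * pi / `|s|).
Proof.
move=> e0 s0; have pi2 : 0 <= 2 * pi :> R by rewrite mulr_ge0 ?pi_ge0.
rewrite gauss_chirpE// gauss_chirp_amplitude// -mulrA normrM.
rewrite ger0_norm ?sqrtr_ge0//.
apply: (@le_trans _ _ (Num.sqrt (2 * pi / Num.sqrt (e ^+ 2 + s ^+ 2)))).
  rewrite ler_piMr ?sqrtr_ge0// normrM mulr_ile1 ?cos_max//.
  rewrite ger0_norm ?expR_ge0// -[leRHS]expR0 ler_expR oppr_le0.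
  by rewrite divr_ge0// mulr_ge0 ?addr_ge0 ?sqr_ge0// ltW.
rewrite ler_sqrt ?divr_ge0// ler_wpM2l// lef_pV2 ?posrE ?normr_gt0//.
  by rewrite -sqrtr_sqr ler_sqrt ?addr_ge0 ?sqr_ge0// lerDr sqr_ge0.
by rewrite sqrtr_gt0 ltr_pwDl ?sqr_ge0 ?exprn_gt0.
Qed.

(** By parity in [s] it is enough to take [s > 0], where [atan (s / e)] tends to
    [pi / 2]: this is where the phase [pi / 4] of the Fresnel density comes from. *)
Lemma gauss_chirp_cvg x s : s != 0 ->
  gauss_chirp (harmonic n) x s 0 @[n --> \oo] -->
  Num.sqrt (2 * pi / `|s|) * cos (pi / 4 - x ^+ 2 / (2 * `|s|)).
Proof.
wlog s_gt0 : s / 0 < s.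
  move=> H s0; have [/H/(_ s0)//|s_le0] := ltP 0 s.
  have := H (- s); rewrite oppr_gt0 lt_neqAle s0 s_le0 oppr_eq0 normrN.
  by under eq_fun do rewrite gauss_chirp_even; apply.
move=> s0; rewrite gtr0_norm//.
have e0 n : 0 < harmonic n :> R by exact: harmonic_gt0.
under eq_fun do rewrite gauss_chirpE// gauss_chirp_amplitude//.
have ce : (harmonic n : R) @[n --> \oo] --> 0 by exact: cvg_harmonic.
have cN : (harmonic n : R) ^+ 2 + s ^+ 2 @[n --> \oo] --> s ^+ 2.
  rewrite -[X in _ --> X]add0r -[0 in X in _ --> X](expr0n R 2).
  apply: cvgD; last exact: cvg_cst.
  exact: (continuous_cvg _ (@exprn_continuous R 2 0) ce).
have s20 : s ^+ 2 != 0 by rewrite sqrf_eq0.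
rewrite -[Num.sqrt (2 * pi / s)]mulr1; apply: cvgM; first apply: cvgM.
- apply: (continuous_cvg _ (@sqrt_continuous R _)).
  apply: cvgM; first exact: cvg_cst.
  apply: cvgV => //.
  rewrite -[X in _ --> X](ger0_norm (ltW s_gt0)) -sqrtr_sqr.
  exact: (continuous_cvg _ (@sqrt_continuous R _) cN).
- have H : x ^+ 2 * harmonic n / (2 * (harmonic n ^+ 2 + s ^+ 2)) @[n --> \oo]
      --> x ^+ 2 * 0 / (2 * s ^+ 2).
    apply: cvgM; first exact: cvgMl_tmp ce.
    by apply: cvgV; [rewrite mulf_neq0|exact: cvgMl_tmp cN].
  rewrite mulr0 mul0r in H.
  have := continuous_cvg _ (@continuous_expR R _) (cvgN H).
  by rewrite oppr0 expR0; apply.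
- apply: (continuous_cvg _ (@continuous_cos R _)).
  apply: cvgB.
    have -> : pi / 4 = pi / 2 / 2 :> R by field.
    apply: cvgM; last exact: cvg_cst.
    apply: ((cvg_pinftyP (@atan R) (pi / 2)).1 (@cvgy_atan R)).
    under eq_fun do rewrite /harmonic invrK.
    apply: (cvg_comp (fun n => n.+1%:R : R) (fun r : R => s * r) (G := +oo)).
      by rewrite (cvg_shiftS (fun n => n%:R : R)); exact: cvgr_idn.
    by apply: gt0_cvgMry => //; exact: cvg_id.
  have -> : x ^+ 2 / (2 * s) = x ^+ 2 * s / (2 * s ^+ 2) by field.
  apply: cvgM; first exact: cvg_cst.
  apply: cvgV; first by rewrite mulf_neq0.
  exact: cvgMl_tmp cN.
Qed.

Definition gauss_density t s := expR (- (s ^+ 2 / (2 * t))) / Num.sqrt (2 * pi * t).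

(** The Fourier multiplier of the semigroup generated by [- (1 / 8) d^4/dx^4]. *)
Definition quartic_symbol t y := expR (- (t / 8 * y ^+ 4)).

Lemma gauss_cos_transform e x : 0 < e ->
  integralT (fun y => expR (- (e / 2 * y ^+ 2)) * cos (x * y)) =
  Num.sqrt (2 * pi / e) * expR (- (x ^+ 2 / (2 * e))).
Proof.
move=> e0; transitivity (gauss_chirp e x 0 0).
  apply: eq_Rintegral => y _.
  by rewrite /gauss_chirp mul0r mul0r addr0 cos0 mulr1.
rewrite gauss_chirpE// gauss_chirp_amplitude// expr0n/= addr0 sqrtr_sqr ger0_norm ?ltW//.
rewrite mul0r atan0 mul0r mulr0 mul0r subrr cos0 mulr1; congr (_ * expR (- _)).
by field; rewrite gt_eqF.
Qed.

Section fixed_time.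
Variable t : R.
Hypothesis t0 : 0 < t.

Lemma gauss_density_ge0 s : 0 <= gauss_density t s.
Proof. by rewrite divr_ge0 ?expR_ge0 ?sqrtr_ge0. Qed.

Let sqt : 0 < Num.sqrt (2 * pi * t).
Proof. by rewrite sqrtr_gt0 !mulr_gt0 ?pi_gt0. Qed.

Lemma continuous_gauss_density : continuous (gauss_density t).
Proof.
by rewrite /gauss_density; smooth; rewrite ?gt_eqF ?mulr_gt0.
Qed.

Lemma gaussian_decay_density : gaussian_decay (gauss_density t).
Proof.
rewrite (_ : gauss_density t = fun s =>
    (Num.sqrt (2 * pi * t))^-1 * expR (- ((2 * t)^-1 * s ^+ 2))).
  apply: gaussian_decay_scale; apply: gaussian_decay_gauss.
  by rewrite invr_gt0 mulr_gt0.
apply/funext => s; rewrite /gauss_density mulrC.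
by congr (_ * expR (- _)); rewrite mulrC.
Qed.

Lemma integrable_gauss_density : integrableT (gauss_density t).
Proof.
apply: gaussian_decay_integrable gaussian_decay_density.
exact: continuous_measurable_fun continuous_gauss_density.
Qed.

Lemma gaussian_decay_symbol : gaussian_decay (quartic_symbol t).
Proof. by apply: gaussian_decay_quartic; rewrite divr_gt0. Qed.

Lemma continuous_symbol : continuous (quartic_symbol t).
Proof. by rewrite /quartic_symbol; smooth. Qed.

Lemma symbol_ge0 y : 0 <= quartic_symbol t y. Proof. exact: expR_ge0. Qed.

Lemma integrable_symbol : integrableT (quartic_symbol t).
Proof.
apply: gaussian_decay_integrable gaussian_decay_symbol.
exact: continuous_measurable_fun continuous_symbol.
Qed.

(** The characteristic function of the centred normal law of variance [t],
    evaluated at [y^2 / 2]. *)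
Lemma gauss_density_transform y :
  integralT (fun s => gauss_density t s * cos (s / 2 * y ^+ 2)) =
  quartic_symbol t y.
Proof.
have := @gauss_cos_transform t^-1 (y ^+ 2 / 2); rewrite invr_gt0 => /(_ t0).
rewrite invrK => H.
transitivity (integralT (fun s => (Num.sqrt (2 * pi * t))^-1 *
   (expR (- (t^-1 / 2 * s ^+ 2)) * cos (y ^+ 2 / 2 * s)))).
  apply: eq_Rintegral => s _; rewrite /gauss_density.
  rewrite [LHS]mulrAC mulrC; congr (_ * (expR (- _) * cos _)); last by field.
  by field; rewrite gt_eqF.
rewrite RintegralZl//.
  rewrite H mulKf ?gt_eqF//; congr (expR (- _)).
  by field; rewrite gt_eqF.
apply: gaussian_decay_integrable.
  by apply: continuous_measurable_fun; smooth.
apply: (gaussian_decay_mul (M := 1)) => [s|]; first exact: cos_max.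
by apply: gaussian_decay_gauss; rewrite divr_gt0 ?invr_gt0.
Qed.

(** The factor [exp (- e y^2 / 2)] makes the double integral absolutely
    convergent.  On the left the integral in [y] has been done first, on the
    right the integral in [s]. *)
Lemma regularised_fubini e x : 0 < e ->
  integralT (fun s => gauss_chirp e x s 0 * gauss_density t s) =
  integralT (fun y => expR (- (e / 2 * y ^+ 2)) *
    (cos (x * y) * quartic_symbol t y)).
Proof.
move=> e0.
pose w y := expR (- (e / 2 * y ^+ 2)).
have gw : gaussian_decay w by apply: gaussian_decay_gauss; rewrite divr_gt0.
have cw : continuous w by rewrite /w; smooth.
have iw : integrableT w.
  exact: gaussian_decay_integrable (continuous_measurable_fun cw) gw.
pose h s y := w y * (cos (x * y) * cos (s / 2 * y ^+ 2 + 0)) * gauss_density t s.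
transitivity (integralT (fun s => integralT (fun y => h s y))).
  apply: eq_Rintegral => s _; rewrite /h /gauss_chirp RintegralZr//.
  apply: gaussian_decay_integrable.
    by apply: continuous_measurable_fun; smooth.
  apply: (gaussian_decay_mul (M := 1)) => // y.
  by rewrite normrM mulr_ile1 ?cos_max.
rewrite (@fubini_dominated R h (gauss_density t) w).
- apply: eq_Rintegral => y _; rewrite -gauss_density_transform mulrA -RintegralZl//.
    by apply: eq_Rintegral => s _; rewrite /h /w addr0; ring.
  apply: gaussian_decay_integrable.
    apply: measurable_funM.
      exact: continuous_measurable_fun continuous_gauss_density.
    by apply: continuous_measurable_fun; smooth.
  apply: (gaussian_decay_mul (M := 1)); last exact: gaussian_decay_density.
  by move=> s; exact: cos_max.
- apply: measurable_funM; last first.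
    apply: (measurableT_comp (continuous_measurable_fun continuous_gauss_density)).
    exact: measurable_fst.
  apply: measurable_funM.
    exact: (measurableT_comp (continuous_measurable_fun cw) measurable_snd).
  apply: measurable_funM.
    apply: measurableT_comp; first exact: continuous_measurable_fun (@continuous_cos R).
    by apply: measurable_funM => //; exact: measurable_snd.
  apply: measurableT_comp; first exact: continuous_measurable_fun (@continuous_cos R).
  apply: measurable_funD => //; apply: measurable_funM.
    by apply: measurable_funM => //; exact: measurable_fst.
  by apply: measurable_funX; exact: measurable_snd.
- exact: integrable_gauss_density.
- exact: iw.
- move=> s y; rewrite /h normrM (ger0_norm (gauss_density_ge0 _)) mulrC.
  rewrite ler_wpM2l ?gauss_density_ge0// normrM ger0_norm ?expR_ge0//.
  by rewrite ler_piMr ?expR_ge0// normrM mulr_ile1 ?cos_max.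
Qed.

End fixed_time.
End fourier_representation.

(** * The Fourier representation of q *)

Section fresnel_fourier.
Context {R : realType}.
Notation mu := (@lebesgue_measure R).
Implicit Types (x y s t e : R).

Lemma sqrt_ratio (a b : R) : 0 < a -> 0 < b ->
  Num.sqrt (a / b) = a * (Num.sqrt (a * b))^-1.
Proof.
move=> a0 b0; rewrite !sqrtrM ?sqrtrV ?ltW//.
rewrite -[X in X * (_ * _)^-1](sqr_sqrtr (ltW a0)).
by field; rewrite ?gt_eqF ?sqrtr_gt0.
Qed.

Lemma measurable_fresnel_density x :
  measurable_fun setT (fun s => fresnel_density s x).
Proof.
apply: measurable_funM.
  apply: (measurableT_comp measurable_invr).
  apply: measurableT_comp; first exact: continuous_measurable_fun (@sqrt_continuous R).
  exact: measurable_funM.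
apply: measurableT_comp; first exact: continuous_measurable_fun (@continuous_cos R).
apply: measurable_funB => //; apply: measurable_funM => //.
by apply: (measurableT_comp measurable_invr); exact: measurable_funM.
Qed.

Lemma measurable_fresnel_density_norm x :
  measurable_fun setT (fun s => fresnel_density `|s| x).
Proof.
apply: (measurableT_comp (measurable_fresnel_density x)).
exact: normr_measurable.
Qed.

Lemma fresnel_density_bound x s :
  `|fresnel_density s x| <= (Num.sqrt (2 * pi * s))^-1.
Proof.
rewrite /fresnel_density normrM ger0_norm ?invr_ge0 ?sqrtr_ge0//.
by rewrite ler_piMr ?invr_ge0 ?sqrtr_ge0// cos_max.
Qed.

Lemma continuous_gauss_chirp e x : 0 < e ->
  continuous (fun s => gauss_chirp e x s 0).
Proof.
move=> e0; under eq_fun do rewrite gauss_chirpE//.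
have N0 s : e ^+ 2 + s ^+ 2 != 0.
  by rewrite gt_eqF// ltr_pwDl ?sqr_ge0 ?exprn_gt0.
by smooth; rewrite ?mulf_neq0// ltr_pwDl ?sqr_ge0.
Qed.

Lemma gauss_chirp_ub e x s : 0 < e ->
  `|gauss_chirp e x s 0| <= Num.sqrt (2 * pi / e).
Proof.
move=> e0; rewrite gauss_chirpE// -2!mulrA normrM ger0_norm ?sqrtr_ge0//.
rewrite ler_piMr ?sqrtr_ge0// normrM mulr_ile1//.
  rewrite ger0_norm ?expR_ge0// -[leRHS]expR0 ler_expR oppr_le0 divr_ge0//.
  by rewrite ln_ge0// lerDl sqr_ge0.
rewrite normrM mulr_ile1 ?cos_max// ger0_norm ?expR_ge0// -[leRHS]expR0 ler_expR.
by rewrite oppr_le0 divr_ge0// mulr_ge0 ?addr_ge0 ?sqr_ge0// ltW.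
Qed.

Variable t : R.
Hypothesis t0 : 0 < t.

Let g := gauss_density t.

Let mg : measurable_fun setT g.
Proof. exact: continuous_measurable_fun (@continuous_gauss_density R t). Qed.

Let integrable_chirp n x :
  integrableT (fun s => gauss_chirp (harmonic n) x s 0 * g s).
Proof.
have e0 : 0 < harmonic n :> R by exact: harmonic_gt0.
apply: (integrable_dominated _ (integrable_mulrl (Num.sqrt (2 * pi / harmonic n))
  (integrable_gauss_density t0))).
  apply: measurable_funM => //.
  exact: continuous_measurable_fun (continuous_gauss_chirp (x := x) e0).
move=> s; rewrite normrM (ger0_norm (gauss_density_ge0 _ _)).
by rewrite ler_wpM2r ?gauss_density_ge0// gauss_chirp_ub.
Qed.

Let cvg_chirp x s : s != 0 ->
  gauss_chirp (harmonic n) x s 0 * g s @[n --> \oo] -->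
  2 * pi * (fresnel_density `|s| x * g s).
Proof.
move=> s0; rewrite mulrA; apply: cvgM; last exact: cvg_cst.
have := gauss_chirp_cvg (x := x) s0.
rewrite sqrt_ratio ?mulr_gt0 ?pi_gt0 ?normr_gt0// /fresnel_density.
by rewrite -[cos (pi / 4 - _)]cosN opprB mulrA.
Qed.

(** At [x = 0] the regularised integrands are nonnegative, their integrals are
    bounded by the integral of the symbol, and they tend to a positive multiple
    of this function; the Fatou lemma applies. *)
Lemma integrable_inv_sqrt_density :
  integrableT (fun s => (Num.sqrt (2 * pi * `|s|))^-1 * g s).
Proof.
have c0 : 0 < cos (pi / 4) :> R.
  by rewrite cos_gt0_pihalf//; have := @pi_gt0 R; lra.
have pi2 : 0 < 2 * pi :> R by rewrite mulr_gt0 ?pi_gt0.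
have H : integrableT (fun s => 2 * pi * (fresnel_density `|s| 0 * g s)).
  apply: (@fatou_integrable R (fun n s => gauss_chirp (harmonic n) 0 s 0 * g s)
    _ (integralT (quartic_symbol t))).
  - by move=> n; exact: integrable_chirp.
  - move=> n s; rewrite mulr_ge0 ?gauss_density_ge0//.
    rewrite gauss_chirpE ?harmonic_gt0// mulr_ge0 ?mulr_ge0 ?sqrtr_ge0 ?expR_ge0//.
    rewrite expr0n/= !mul0r subr0 cos_ge0_pihalf//.
    have := atan_gtNpi2 (s / harmonic n); have := atan_ltpi2 (s / harmonic n).
    by have := @pi_gt0 R; lra.
  - apply: measurable_funM => //; apply: measurable_funM => //.
    exact: measurable_fresnel_density_norm.
  - move=> s; rewrite mulr_ge0 ?(ltW pi2)// mulr_ge0 ?gauss_density_ge0//.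
    rewrite mulr_ge0 ?invr_ge0 ?sqrtr_ge0// expr0n/= mul0r sub0r cosN.
    exact: ltW.
  - by move=> s; exact: cvg_chirp.
  - move=> n; have e0 : 0 < harmonic n :> R by exact: harmonic_gt0.
    rewrite (regularised_fubini t0)//; apply: le_Rintegral => //.
    + apply: (integrable_dominated _ (integrable_symbol t0)).
        apply: measurable_funM; first by apply: continuous_measurable_fun; smooth.
        apply: measurable_funM; first by apply: continuous_measurable_fun; smooth.
        exact: continuous_measurable_fun (@continuous_symbol R t).
      move=> y; rewrite mul0r cos0 mul1r normrM (ger0_norm (symbol_ge0 _ _)).
      rewrite ler_piMl ?symbol_ge0// ger0_norm ?expR_ge0// -[leRHS]expR0 ler_expR.
      by rewrite oppr_le0 mulr_ge0 ?sqr_ge0// divr_ge0// ltW.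
    + exact: integrable_symbol.
    + move=> y _; rewrite mul0r cos0 mul1r ler_piMl ?expR_ge0// -[leRHS]expR0 ler_expR.
      by rewrite oppr_le0 mulr_ge0 ?sqr_ge0// divr_ge0// ltW.
have := integrable_mulrl (2 * pi * cos (pi / 4))^-1 H.
congr (_.-integrable _ _); apply/funext => s /=; congr EFin.
rewrite /fresnel_density expr0n/= mul0r sub0r cosN.
have cn : cos (pi / 4) != 0 :> R by rewrite gt_eqF.
have pn : pi != 0 :> R by rewrite gt_eqF ?pi_gt0.
move: (pi : R) pn (cos (pi / 4)) cn (Num.sqrt (2 * pi * `|s|))^-1 => p pn c cn z.
by field; rewrite cn pn.
Qed.

Lemma integrable_fresnel_density x :
  integrableT (fun s => fresnel_density `|s| x * g s).
Proof.
apply: (integrable_dominated _ integrable_inv_sqrt_density).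
  by apply: measurable_funM => //; exact: measurable_fresnel_density_norm.
move=> s; rewrite normrM (ger0_norm (gauss_density_ge0 _ _)).
by rewrite ler_wpM2r ?gauss_density_ge0// fresnel_density_bound.
Qed.

Lemma integrable_cos_symbol x :
  integrableT (fun y => cos (x * y) * quartic_symbol t y).
Proof.
apply: (integrable_dominated _ (integrable_symbol t0)).
  apply: measurable_funM; first by apply: continuous_measurable_fun; smooth.
  exact: continuous_measurable_fun (@continuous_symbol R t).
by move=> y; rewrite normrM (ger0_norm (symbol_ge0 _ _)) ler_piMl ?symbol_ge0 ?cos_max.
Qed.

(** The limit [e -> 0], along [e = 1 / (n + 1)], of both sides of
    [regularised_fubini]. *)
Lemma fresnel_density_fourier x :
  integralT (fun s => fresnel_density `|s| x * g s) =
  (2 * pi)^-1 * integralT (fun y => cos (x * y) * quartic_symbol t y).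
Proof.
have pi2 : 2 * pi != 0 :> R by rewrite gt_eqF// mulr_gt0 ?pi_gt0.
apply: (mulfI pi2); rewrite mulVKf// -RintegralZl//; last first.
  exact: integrable_fresnel_density.
have H1 : integralT (fun s => gauss_chirp (harmonic n) x s 0 * g s) @[n --> \oo] -->
    integralT (fun s => 2 * pi * (fresnel_density `|s| x * g s)).
  apply: (dominated_cvg_integral
    (g := fun s => 2 * pi * ((Num.sqrt (2 * pi * `|s|))^-1 * g s))).
  - by move=> n; apply: integrable_measurable; exact: integrable_chirp.
  - apply: integrable_measurable; apply: integrable_mulrl.
    exact: integrable_fresnel_density.
  - by apply: integrable_mulrl; exact: integrable_inv_sqrt_density.
  - by move=> s; exact: cvg_chirp.
  - move=> n s s0; rewrite normrM (ger0_norm (gauss_density_ge0 _ _)) [leRHS]mulrA.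
    rewrite ler_wpM2r ?gauss_density_ge0//.
    rewrite -sqrt_ratio ?mulr_gt0 ?pi_gt0 ?normr_gt0//.
    by apply: gauss_chirp_bound => //; exact: harmonic_gt0.
have H2 : integralT (fun s => gauss_chirp (harmonic n) x s 0 * g s) @[n --> \oo] -->
    integralT (fun y => cos (x * y) * quartic_symbol t y).
  under eq_fun do rewrite (regularised_fubini t0) ?harmonic_gt0//.
  apply: (dominated_cvg_integral (g := fun y => `|cos (x * y) * quartic_symbol t y|)).
  - move=> n; apply: measurable_funM.
      by apply: continuous_measurable_fun; smooth.
    by apply: integrable_measurable; exact: integrable_cos_symbol.
  - by apply: integrable_measurable; exact: integrable_cos_symbol.
  - by apply: integrable_norm; exact: integrable_cos_symbol.
  - move=> y _; rewrite -[X in _ --> X]mul1r; apply: cvgM; last exact: cvg_cst.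
    have ce : - (harmonic n / 2 * y ^+ 2) @[n --> \oo] --> - (0 / 2 * y ^+ 2).
      apply: cvgN; apply: cvgM; last exact: cvg_cst.
      by apply: cvgM; [exact: cvg_harmonic|exact: cvg_cst].
    have := continuous_cvg _ (@continuous_expR R _) ce.
    by rewrite !mul0r oppr0 expR0; apply.
  - move=> n y _; rewrite normrM ler_piMl// ger0_norm ?expR_ge0// -[leRHS]expR0 ler_expR.
    by rewrite oppr_le0 mulr_ge0 ?sqr_ge0// divr_ge0// ltW// harmonic_gt0.
by rewrite -(cvg_lim _ H1)// -(cvg_lim _ H2).
Qed.

Lemma q_line_integral x :
  q x t = integralT (fun s => fresnel_density `|s| x * g s).
Proof.
rewrite integral_even; last 2 first.
- exact: integrable_fresnel_density.
- by move=> s; rewrite normrN /g /gauss_density sqrrN.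
congr (_ * _); apply: eq_Rintegral => s; rewrite inE/= in_itv/= andbT => s0.
by rewrite gtr0_norm.
Qed.

Lemma q_fourier x :
  q x t = (2 * pi)^-1 * integralT (fun y => cos (x * y) * quartic_symbol t y).
Proof. by rewrite q_line_integral fresnel_density_fourier. Qed.

End fresnel_fourier.

(** * Integration against the law of the reflected Brownian motion *)

Section composition_density.
Context {R : realType} d (T : measurableType d) (P : probability T R).
Notation mu := (@lebesgue_measure R).
Local Open Scope ereal_scope.

(** The density of the normal law is its Radon-Nikodym derivative, up to a null
    set. *)
Lemma ge0_integral_normal_prob (m s : R) (h : R -> \bar R) :
  measurable_fun setT h -> (forall y, 0 <= h y) ->
  \int[normal_prob m s]_y h y = \int[mu]_y (h y * (normal_pdf m s y)%:E).
Proof.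
move=> mh h0.
have dom := normal_prob_dominates m s.
have mh' : measurable_fun (T := measurableTypeR R) setT h by exact: mh.
rewrite -(Radon_Nikodym_SigmaFinite.change_of_variables dom h0 measurableT mh').
have If := Radon_Nikodym_SigmaFinite.f_integrable dom.
have mpdf : measurable_fun (T := measurableTypeR R) setT
    (fun y => (normal_pdf m s y)%:E).
  by apply/measurable_EFinP; exact: measurable_normal_pdf.
apply: ae_eq_integral => //.
- by apply: emeasurable_funM => //; exact: measurable_int If.
- by apply: emeasurable_funM.
- apply: ae_eqe_mul2l; apply: integral_ae_eq => //.
  by move=> E _ mE; rewrite -Radon_Nikodym_SigmaFinite.f_integral.
Qed.

Lemma ge0_integral_normal_law (X : T -> R) (s : R) (h : R -> \bar R) :
  measurable_fun setT X ->
  (forall A, measurable A -> pushforward P X A = normal_prob 0 s A) ->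
  measurable_fun setT h -> (forall y, 0 <= h y) ->
  \int[P]_w h (X w) = \int[mu]_y (h y * (normal_pdf 0 s y)%:E).
Proof.
move=> mX lawX mh h0; rewrite -ge0_integral_normal_prob//.
have mX' : measurable_fun (U := measurableTypeR R) setT X by exact: mX.
pose X' : {mfun T >-> measurableTypeR R} :=
  HB.pack X (isMeasurableFun.Build _ _ _ _ _ mX').
transitivity (\int[pushforward P X']_y h y).
  by rewrite (ge0_integral_pushforward mX').
by apply: eq_measure_integral => A mA _; exact: lawX.
Qed.

Variable B : R -> {RV P >-> R}.
Hypothesis brownian_B : standard_brownian_motion B.
Variable t : R.
Hypothesis t0 : (0 < t)%R.

Lemma normal_pdf_gauss_density s :
  normal_pdf 0 (Num.sqrt t) s = gauss_density t s.
Proof.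
rewrite normal_pdfE ?gt_eqF ?sqrtr_gt0// /normal_peak /normal_fun sqr_sqrtr ?ltW//.
rewrite subr0 mulrC /gauss_density mulNr; congr (expR (- (_ / _)) / Num.sqrt _)%R.
  by rewrite mulr_natl.
by rewrite -mulr_natl; ring.
Qed.

(** The increment [B t - B 0] is normal, and [B 0] vanishes almost surely. *)
Lemma ge0_integral_brownian (h : R -> \bar R) :
  measurable_fun setT h -> (forall y, 0 <= h y) ->
  \int[P]_w h (B t w) = \int[mu]_y (h y * (gauss_density t y)%:E).
Proof.
move=> mh h0; have mBt : measurable_fun setT (B t) by exact: measurable_funP.
have mB0 : measurable_fun setT (B 0%R) by exact: measurable_funP.
transitivity (\int[P]_w h ((B t \- B 0%R)%R w)).
  apply: ae_eq_integral => //.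
  - exact: measurableT_comp.
  - by apply: measurableT_comp => //; exact: measurable_funB.
  - by apply: filterS (bm_start brownian_B) => w Bw0 _ /=; rewrite Bw0 subr0.
rewrite (@ge0_integral_normal_law (B t \- B 0%R)%R (Num.sqrt t))//.
- by apply: eq_integral => y _; rewrite normal_pdf_gauss_density.
- move=> A mA; have := bm_gaussian_increments brownian_B (lexx 0%R) t0 mA.
  by rewrite subr0.
Qed.

(** The Gaussian density is even, so each of the half-lines contributes once. *)
Lemma ge0_integral_abs_law (h : R -> \bar R) :
  measurable_fun setT h -> (forall y, 0 <= h y) ->
  \int[abs_law B t]_(s in `]0%R, +oo[) h s =
  2%:E * \int[mu]_(s in `]0%R, +oo[) (h s * (gauss_density t s)%:E).
Proof.
move=> mh h0; have mBt : measurable_fun setT (B t) by exact: measurable_funP.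
pose hD := h \_ `]0%R, +oo[.
have mhD : measurable_fun setT hD.
  by apply/(measurable_restrictT _ _).1 => //; exact: measurable_funTS.
have point0 : point = 0 :> \bar R by [].
have hD0 y : 0 <= hD y by rewrite /hD patchE; case: ifPn.
pose u y := hD y * (gauss_density t y)%:E.
have mu_ : measurable_fun setT u.
  apply: emeasurable_funM => //; apply/measurable_EFinP.
  exact: continuous_measurable_fun (@continuous_gauss_density R t).
have u0 y : 0 <= u y by rewrite mule_ge0// lee_fin gauss_density_ge0.
have mphi : measurable_fun setT (fun w => `|B t w|%R).
  by apply: measurableT_comp => //; exact: normr_measurable.
rewrite [LHS]integral_mkcond /abs_law (ge0_integral_pushforward mphi)//=.
rewrite (ge0_integral_brownian (h := fun y => hD `|y|%R))//; last first.
  by apply: measurableT_comp => //; exact: normr_measurable.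
transitivity (\int[mu]_y (u y + u (- y)%R)).
  apply: eq_integral => y _; rewrite /u /hD !patchE !mem_setE !in_itv/= !andbT.
  rewrite oppr_gt0 normr_gt0 /gauss_density sqrrN.
  case: ltgtP => y0 /=; rewrite ?point0 ?mul0e ?adde0 ?add0e//.
    by rewrite gtr0_norm.
  by rewrite ltr0_norm.
rewrite ge0_integralD//; last first.
  by apply: measurableT_comp => //; exact: oppr_measurable.
rewrite ge0_integral_reflection// mule_natl mule2n.
suff -> : \int[mu]_x u x =
  \int[mu]_(s in `]0%R, +oo[) (h s * (gauss_density t s)%:E) by [].
rewrite [RHS]integral_mkcond; apply: eq_integral => y _.
by rewrite /u /hD !patchE; case: ifPn => //; rewrite point0 mul0e.
Qed.

Lemma integral_abs_law_fresnel x :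
  (abs_law B t).-integrable `]0%R, +oo[ (fun s => (fresnel_density s x)%:E) /\
  \int[abs_law B t]_(s in `]0%R, +oo[) (fresnel_density s x)%:E = (q x t)%:E.
Proof.
pose f s := fresnel_density s x; pose g := gauss_density t.
have mf : measurable_fun setT (EFin \o f).
  by apply/measurable_EFinP; exact: measurable_fresnel_density.
have ifg : mu.-integrable `]0%R, +oo[ (fun s => (f s * g s)%:E).
  have I := integrable_fresnel_density t0 x.
  apply: (@eq_integrable _ _ _ mu _ _
    (EFin \o (fun s => (fresnel_density `|s| x * g s)%R))) => //.
    by move=> s; rewrite inE/= in_itv/= andbT => s0; rewrite gtr0_norm.
  exact: (integrableS measurableT _ _ I).
split.
  apply/integrableP; split; first exact: measurable_funTS.
  rewrite (ge0_integral_abs_law (h := fun s => `|(f s)%:E|))//; last first.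
    exact: measurableT_comp.
  have /integrableP[_] := ifg.
  under eq_integral do
    rewrite EFinM abseM (gee0_abs (x := (g _)%:E)) ?lee_fin ?gauss_density_ge0//.
  by move=> fin; rewrite lte_mul_pinfty.
have posM s : (EFin \o f)^\+ s * (g s)%:E = (fun s => (f s * g s)%:E)^\+ s.
  by rewrite !funeposE /= -!EFin_max -EFinM maxr_pMl ?gauss_density_ge0// mul0r.
have negM s : (EFin \o f)^\- s * (g s)%:E = (fun s => (f s * g s)%:E)^\- s.
  by rewrite !funenegE /= -!EFin_max -EFinM maxr_pMl ?gauss_density_ge0// mul0r mulNr.
have mphi : measurable_fun setT (fun w => `|B t w|%R).
  by apply: measurableT_comp => //; exact: normr_measurable.
transitivity (\int[abs_law B t]_(s in `]0%R, +oo[) (EFin \o f)^\+ s -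
    \int[abs_law B t]_(s in `]0%R, +oo[) (EFin \o f)^\- s).
  by rewrite [LHS]integralE.
rewrite (ge0_integral_abs_law (h := (EFin \o f)^\+))//; last exact: measurable_funepos.
rewrite (ge0_integral_abs_law (h := (EFin \o f)^\-))//; last exact: measurable_funeneg.
under [X in 2%:E * X - _]eq_integral do rewrite posM.
under [X in _ - 2%:E * X]eq_integral do rewrite negM.
have fin := integrable_fin_num _ ifg.
rewrite -muleBr//; last first.
  by rewrite fin_num_adde_defr// integrable_pos_fin_num.
rewrite -integralE /q EFinM; congr (_ * _); rewrite /Rintegral fineK//.
by apply: fin.
Qed.

End composition_density.

(** * The fourth-order heat equation *)

Section heat_equation.
Context {R : realType}.
Implicit Types (x y t : R).

Lemma is_derive_fun_scale c (f : R -> R) x a : is_derive x 1 f a ->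
  is_derive x 1 (fun y => c * f y) (c * a).
Proof. by move=> fa; derive; rewrite mul0r add0r. Qed.

(** Each derivative of [cos (x y)] in [x] adds [pi / 2] to its argument and a
    factor [y]; writing the phase as [n pi / 2] treats all orders at once. *)
Definition fourier_moment n x t :=
  integralT (fun y => y ^+ n * quartic_symbol t y * cos (x * y + n%:R * (pi / 2))).

Lemma q_moment t x : 0 < t -> q x t = (2 * pi)^-1 * fourier_moment 0 x t.
Proof.
move=> t0; rewrite q_fourier//; congr (_ * _); apply: eq_Rintegral => y _.
by rewrite expr0 mul1r mul0r addr0 mulrC.
Qed.

Let continuous_moment n t : continuous (fun y => y ^+ n * quartic_symbol t y).
Proof. by rewrite /quartic_symbol; smooth. Qed.

Let decay_moment n t : 0 < t ->
  gaussian_decay (fun y => y ^+ n * quartic_symbol t y).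
Proof. by move=> t0; apply: gaussian_decay_mulXn; exact: gaussian_decay_symbol. Qed.

Lemma integrable_moment n x t : 0 < t ->
  integrableT (fun y => y ^+ n * quartic_symbol t y * cos (x * y + n%:R * (pi / 2))).
Proof.
move=> t0; apply: gaussian_decay_integrable.
  apply: measurable_funM; first exact: continuous_measurable_fun (@continuous_moment n t).
  by apply: continuous_measurable_fun; smooth.
by apply: (gaussian_decay_mul (M := 1)) (decay_moment n t0) => y; exact: cos_max.
Qed.

Let integrable_norm_moment n t : 0 < t ->
  integrableT (fun y => `|y ^+ n * quartic_symbol t y|).
Proof.
move=> t0; apply: gaussian_decay_integrable; last exact/gaussian_decay_norm/decay_moment.
apply: measurableT_comp => //; exact: continuous_measurable_fun (@continuous_moment n t).
Qed.

Lemma is_derive_moment_x n t x : 0 < t ->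
  is_derive x 1 (fun z => fourier_moment n z t) (fourier_moment n.+1 x t).
Proof.
move=> t0; apply: (@is_derive_integralT R
  (fun x y => y ^+ n * quartic_symbol t y * cos (x * y + n%:R * (pi / 2)))
  (fun x y => y ^+ n.+1 * quartic_symbol t y * cos (x * y + n.+1%:R * (pi / 2)))
  (fun y => `|y ^+ n.+1 * quartic_symbol t y|) x (x - 1) (x + 1)).
- lra.
- by move=> z _; exact: integrable_moment.
- move=> z y _; derive => /=.
  have -> : z * y + n.+1%:R * (pi / 2) = z * y + n%:R * (pi / 2) + pi / 2.
    by rewrite -natr1; ring.
  by rewrite cosDpihalf exprS; ring.
- exact: integrable_norm_moment.
- by move=> z y _; rewrite normrM ler_piMr// cos_max.
Qed.

(** The symbol at time [t / 2] dominates the derivative near [t]. *)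
Lemma is_derive_moment_t t x : 0 < t ->
  is_derive t 1 (fun r => fourier_moment 0 x r) (- (1 / 8) * fourier_moment 4 x t).
Proof.
move=> t0; rewrite -RintegralZl//; last exact: integrable_moment.
apply: (@is_derive_integralT R
  (fun t y => y ^+ 0 * quartic_symbol t y * cos (x * y + 0%:R * (pi / 2)))
  (fun t y => - (1 / 8) * (y ^+ 4 * quartic_symbol t y * cos (x * y + 4%:R * (pi / 2))))
  (fun y => `|y ^+ 4 * quartic_symbol (t / 2) y|) t (t / 2) (t + 1)).
- lra.
- by move=> r rt; apply: integrable_moment; lra.
- move=> r y _; rewrite /quartic_symbol; derive => /=.
  have -> : x * y + 4%:R * (pi / 2) = x * y + 0 * (pi / 2) + pi *+ 2.
    by rewrite -mulr_natl; field.
  by rewrite cosD2pi; field.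
- by apply: integrable_norm_moment; lra.
- move=> r y rt; rewrite normrM (normrM (y ^+ 4 * _)) (normrM (y ^+ 4)).
  rewrite (normrM (y ^+ 4)); set a := `|y ^+ 4|; set b := `|quartic_symbol r y|.
  have -> : `|- (1 / 8)| = 1 / 8 :> R by rewrite normrN ger0_norm ?divr_ge0.
  apply: (@le_trans _ _ (1 * (a * b))).
    have ab : 0 <= a * b by rewrite /a /b mulr_ge0.
    by apply: ler_pM; [lra|rewrite mulr_ge0|lra|rewrite ler_piMr// cos_max].
  rewrite mul1r ler_wpM2l ?normr_ge0// /b !ger0_norm ?symbol_ge0// ler_expR lerN2.
  by rewrite ler_wpM2r ?exprn_even_ge0//; lra.
Qed.

Lemma derive1n_q n t x : 0 < t ->
  derive1n n (fun y => q y t) x = (2 * pi)^-1 * fourier_moment n x t.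
Proof.
move=> t0; elim: n x => [|n ih] x; first by rewrite /= q_moment.
rewrite derive1nS (_ : derive1n n _ =
    fun x => (2 * pi)^-1 * fourier_moment n x t); last first.
  by apply/funext => z; rewrite ih.
rewrite derive1E.
by have [_ ->] := is_derive_fun_scale (2 * pi)^-1 (is_derive_moment_x n x t0).
Qed.

Lemma derivable_derive1n_q n t x : 0 < t ->
  derivable (derive1n n (fun y => q y t)) x 1.
Proof.
move=> t0; rewrite (_ : derive1n n _ =
    fun x => (2 * pi)^-1 * fourier_moment n x t); last first.
  by apply/funext => z; rewrite derive1n_q.
by have [] := is_derive_fun_scale (2 * pi)^-1 (is_derive_moment_x n x t0).
Qed.

Lemma is_derive_q_t t x : 0 < t ->
  is_derive t 1 (fun r => q x r) (- (1 / 8) * ((2 * pi)^-1 * fourier_moment 4 x t)).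
Proof.
move=> t0.
apply: (@near_eq_is_derive _ _ _ (fun r => (2 * pi)^-1 * fourier_moment 0 x r)).
  by near=> r; rewrite q_moment//; near: r; exact: lt_nbhsr.
apply: is_derive_cong.
  exact: (is_derive_fun_scale _ (is_derive_moment_t x t0)).
by ring.
Unshelve. all: end_near. Qed.

Lemma q_heat_eq : fourth_order_heat_eq (@q R).
Proof.
move=> x t t0; have dt := is_derive_q_t x t0; split.
- by have [] := dt.
- by move=> k _; exact: derivable_derive1n_q.
- rewrite derive1E (@derive_val _ _ _ _ _ _ _ dt) derive1n_q//.
  by congr (- (1 / _) * _); rewrite !exprS expr0; ring.
Qed.

End heat_equation.

(** * Spatial decay of q *)

Section initial_condition.
Context {R : realType}.
Notation mu := (@lebesgue_measure R).
Implicit Types (x y s t : R).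

Lemma integrable_cauchy : integrableT (fun y : R => (1 + y ^+ 2)^-1).
Proof.
have cV : continuous (fun y : R => (1 + y ^+ 2)^-1) by exact: continuous_oneDsqrV.
have V0 y : 0 <= (1 + y ^+ 2)^-1 :> R by rewrite invr_ge0 addr_ge0 ?sqr_ge0.
apply/integrableP; split.
  by apply/measurable_EFinP; exact: continuous_measurable_fun cV.
under eq_integral do rewrite gee0_abs ?lee_fin//.
rewrite ge0_symfun_integralT//; last by move=> y /=; rewrite sqrrN.
have := @integral0y_oneDsqr R; rewrite set_itvcy /oneDsqr => ->.
by rewrite -EFinM ltry.
Qed.

(** The second derivative of the symbol in [y]. *)
Definition symbol_dd t y :=
  (t ^+ 2 / 4 * y ^+ 6 - 3 * t / 2 * y ^+ 2) * quartic_symbol t y.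

Lemma continuous_symbol_dd t : continuous (symbol_dd t).
Proof. by rewrite /symbol_dd /quartic_symbol; smooth. Qed.

(** With [u = t y^4 / 8], the second derivative is at most
    [(12 u + 16 u^2) exp (- u) / y^2], hence at most [44 / y^2]; for [|y| <= 1]
    it is bounded by [2].  Such a bound, uniform in [t], is what dominated
    convergence requires as [t] tends to [0]. *)
Lemma symbol_dd_bound t y : 0 < t <= 1 -> `|symbol_dd t y| <= 88 * (1 + y ^+ 2)^-1.
Proof.
move=> /andP[t0 t1]; rewrite ler_pdivlMr ?ltr_pwDl ?sqr_ge0//.
rewrite /symbol_dd normrM (ger0_norm (symbol_ge0 _ _)).
pose z := y ^+ 2; have z0 : 0 <= z by exact: sqr_ge0.
have y4 : y ^+ 4 = z ^+ 2 by rewrite /z -exprM.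
have y6 : y ^+ 6 = z ^+ 3 by rewrite /z -exprM.
pose u := t / 8 * z ^+ 2.
have u0 : 0 <= u by rewrite /u mulr_ge0 ?sqr_ge0// divr_ge0// ltW.
have -> : quartic_symbol t y = (expR u)^-1 by rewrite /quartic_symbol y4 -expRN.
have e1 : 1 + u <= expR u by exact: expR_ge1Dx.
have e2 : 1 + u ^+ 2 / 2 <= expR u by have := @expR_ge1Dxn R u 1 u0.
rewrite mulrAC ler_pdivrMr ?expR_gt0// y6 -/z.
clearbody z.
have a0 : 0 <= t ^+ 2 / 4 * z ^+ 3.
  by have := mulr_ge0 (sqr_ge0 t) (exprn_ge0 3 z0); lra.
have b0 : 0 <= 3 * t / 2 * z by have := mulr_ge0 (ltW t0) z0; lra.
have zn : `|t ^+ 2 / 4 * z ^+ 3 - 3 * t / 2 * z| <= t ^+ 2 / 4 * z ^+ 3 + 3 * t / 2 * z.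
  by rewrite ler_norml; apply/andP; split; lra.
apply: (le_trans (ler_wpM2r _ zn)); first by rewrite addr_ge0.
move: zn => _; set w := t ^+ 2 / 4 * z ^+ 3 + _; have w0 : 0 <= w by exact: addr_ge0.
have [z1|z1] := leP z 1.
  apply: (@le_trans _ _ (88 * 1)); last by rewrite ler_wpM2l// (le_trans _ e1)// lerDl.
  have tz : t ^+ 2 * z ^+ 3 <= 1.
    apply: mulr_ile1; rewrite ?exprn_ge0 ?exprn_ile1 ?(ltW t0)//.
  have tz' : t * z <= 1 by apply: mulr_ile1 => //; exact: ltW.
  apply: (@le_trans _ _ (2 * 2)); last lra.
  by apply: ler_pM => //; rewrite ?addr_ge0 /w//; lra.
have -> : 88 * expR u = 2 * (44 * expR u) by ring.
apply: (@le_trans _ _ (w * (2 * z))); first by rewrite ler_wpM2l//; lra.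
have -> : w * (2 * z) = 2 * (16 * u ^+ 2 + 12 * u) by rewrite /w /u; field.
by rewrite ler_wpM2l//; lra.
Qed.

Lemma integrable_symbol_dd t : 0 < t -> integrableT (symbol_dd t).
Proof.
move=> t0; apply: gaussian_decay_integrable.
  exact: continuous_measurable_fun (@continuous_symbol_dd t).
rewrite (_ : symbol_dd t = fun y => t ^+ 2 / 4 * (y ^+ 6 * quartic_symbol t y) +
    - (3 * t / 2) * (y ^+ 2 * quartic_symbol t y)); last first.
  by apply/funext => y; rewrite /symbol_dd; ring.
apply: gaussian_decay_add; apply: gaussian_decay_scale;
  by apply: gaussian_decay_mulXn; exact: gaussian_decay_symbol.
Qed.

Lemma cvg_integral_symbol_dd (u : nat -> R) :
  (forall n, 0 < u n <= 1) -> u n @[n --> \oo] --> 0 ->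
  integralT (fun y => `|symbol_dd (u n) y|) @[n --> \oo] --> 0.
Proof.
move=> u01 cu.
have -> : 0 = integralT (fun _ : R => 0) :> R by rewrite Rintegral_cst// mul0r.
apply: (dominated_cvg_integral (g := fun y => 88 * (1 + y ^+ 2)^-1)) => //.
- move=> n; apply: measurableT_comp => //.
  exact: continuous_measurable_fun (@continuous_symbol_dd _).
- exact: integrable_mulrl integrable_cauchy.
- move=> y _; rewrite -(normr0 R).
  have c : continuous (fun t => symbol_dd t y).
    by rewrite /symbol_dd /quartic_symbol; smooth.
  have c0 := continuous_cvg _ (c 0) cu.
  have s0 : symbol_dd 0 y = 0 by rewrite /symbol_dd; ring.
  rewrite s0 in c0.
  by apply: cvg_norm; exact: c0.
- by move=> n y _; rewrite normr_id symbol_dd_bound.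
Qed.

(** Integrate over the line the derivative of
    [f' cos (x y) + x f sin (x y)], where [f] is the symbol: it equals
    [f'' cos (x y) + x^2 f cos (x y)]. *)
Lemma q_sqr_bound t x : 0 < t ->
  x ^+ 2 * `|q x t| <= (2 * pi)^-1 * integralT (fun y => `|symbol_dd t y|).
Proof.
move=> t0; have pi2 : 0 < (2 * pi)^-1 :> R by rewrite invr_gt0 mulr_gt0 ?pi_gt0.
have gs := gaussian_decay_symbol t0.
have isd := integrable_symbol_dd t0.
have ic := integrable_cos_symbol t0 x.
have isc : integrableT (fun y => symbol_dd t y * cos (x * y)).
  apply: (integrable_dominated _ (integrable_norm isd)) => [|y].
    apply: measurable_funM.
      exact: continuous_measurable_fun (@continuous_symbol_dd t).
    by apply: continuous_measurable_fun; smooth.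
  by rewrite normrM ler_piMr// cos_max.
have H : integralT (fun y => symbol_dd t y * cos (x * y) +
    x ^+ 2 * (cos (x * y) * quartic_symbol t y)) = 0.
  apply: (@integral_derivative_eq0 R (fun y =>
      - (t / 2) * (y ^+ 3 * quartic_symbol t y) * cos (x * y) +
      x * quartic_symbol t y * sin (x * y))).
  - move=> y; rewrite /symbol_dd /quartic_symbol; derive => /=; by field.
  - by rewrite /symbol_dd /quartic_symbol; smooth.
  - by apply: integrable_addr => //; exact: integrable_mulrl.
  all: have gF : gaussian_decay (fun y =>
      - (t / 2) * (y ^+ 3 * quartic_symbol t y) * cos (x * y) +
      x * quartic_symbol t y * sin (x * y)) by
    apply: gaussian_decay_add; [apply: (gaussian_decay_mul (M := 1)) => [y|];
      [exact: cos_max|apply: gaussian_decay_scale; exact: gaussian_decay_mulXn]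
    |apply: (gaussian_decay_mul (M := 1)) => [y|];
      [exact: sin_max|exact: gaussian_decay_scale]].
  by have [] := gaussian_decay_cvg gF.
  by have [] := gaussian_decay_cvg gF.
rewrite RintegralD// in H; last exact: integrable_mulrl.
rewrite RintegralZl// in H.
rewrite q_fourier// normrM (gtr0_norm pi2) mulrCA ler_wpM2l ?(ltW pi2)//.
rewrite -(ger0_norm (sqr_ge0 x)) -normrM.
have -> : x ^+ 2 * integralT (fun y => cos (x * y) * quartic_symbol t y) =
  - integralT (fun y => symbol_dd t y * cos (x * y)).
  by apply/eqP; rewrite -addr_eq0 addrC H.
rewrite normrN; apply: (le_trans (le_normr_Rintegral measurableT isc)).
apply: le_Rintegral => //; [exact: integrable_norm|exact: integrable_norm|].
by move=> y _; rewrite normrM ler_piMr// cos_max.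
Qed.

End initial_condition.

(** * The initial condition *)

Section test_functions.
Context {R : realType}.
Implicit Types (x y : R) (f phi : R -> R).

Definition unit_gauss x := expR (- (1 / 2 * x ^+ 2)).

Lemma unit_gauss_le1 x : unit_gauss x <= 1.
Proof.
by rewrite -[leRHS]expR0 ler_expR oppr_le0 mulr_ge0 ?sqr_ge0// divr_ge0.
Qed.

Lemma continuous_unit_gauss : continuous unit_gauss.
Proof. by rewrite /unit_gauss; smooth. Qed.

Lemma mulX_unit_gauss_le1 x : `|x * unit_gauss x| <= 1.
Proof.
rewrite normrM (ger0_norm (expR_ge0 _)) /unit_gauss expRN.
rewrite ler_pdivrMr ?expR_gt0// [leRHS]mul1r.
apply: (le_trans _ (expR_ge1Dx _)).
rewrite -(real_normK (num_real x)).
by have := sqr_ge0 (`|x| - 1); have := normr_ge0 x; lra.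
Qed.

Lemma mean_value_origin f df x : (forall z : R, is_derive z 1 f (df z)) ->
  exists2 c, `|c| <= `|x| & f x - f 0 = df c * x.
Proof.
move=> fd; have cf := is_derive_continuous fd.
have [x0|x0] := leP 0 x.
  have [c] := MVT_segment x0 (fun z _ => fd z) (continuous_subspaceT cf).
  rewrite in_itv/= subr0 => /andP[c0 cx] E; exists c => //.
  by rewrite !ger0_norm.
have [c] := MVT_segment (ltW x0) (fun z _ => fd z) (continuous_subspaceT cf).
rewrite in_itv/= sub0r => /andP[xc c0] E; exists c.
  by rewrite ler0_norm// ltr0_norm// lerN2.
by rewrite -opprB E mulrN opprK.
Qed.

Lemma continuous_bound_segment f a : continuous f -> 0 <= a ->
  exists2 M, 0 <= M & forall x, `|x| <= a -> `|f x| <= M.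
Proof.
move=> cf a0; have [||c _ fc] := @EVT_max R (fun x => `|f x|) (- a) a.
- lra.
- by apply: continuous_subspaceT => x; apply: cvg_norm; exact: cf.
by exists `|f c| => // x xa; apply: fc; rewrite in_itv/= -ler_norml.
Qed.

Lemma test_function_derive phi n x : test_function phi ->
  is_derive x 1 (derive1n n phi) (derive1n n.+1 phi x).
Proof.
by move=> [dphi _]; rewrite derive1nS derive1E; apply: DeriveDef => //; exact: dphi.
Qed.

Lemma test_function_continuous phi : test_function phi -> continuous phi.
Proof.
move=> tphi; apply: (is_derive_continuous (df := derive1n 1 phi)) => x.
exact: (test_function_derive 0 x tphi).
Qed.

Lemma test_function_bounded phi : test_function phi ->
  exists2 M, 0 <= M & forall x, `|phi x| <= M.
Proof.
move=> tphi; have cphi := test_function_continuous tphi.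
have [_ /compact_bounded[A [_ HA]]] := tphi.
pose a := Num.max (A + 1) 0.
have [|M M0 HM] := @continuous_bound_segment phi a cphi.
  by rewrite le_max lexx orbT.
exists M => // x; have [->|px0] := eqVneq (phi x) 0; first by rewrite normr0.
apply: HM; apply: (@le_trans _ _ (A + 1)); last by rewrite le_max lexx.
by apply: (HA (A + 1)); [rewrite ltrDl|exact: subset_closure].
Qed.

(** What is subtracted is chosen to have the value and the slope of [phi] at
    the origin, and to have a pairing with [q] that is explicit or zero. *)
Definition gauss_remainder phi x :=
  phi x - phi 0 * unit_gauss x - derive1n 1 phi 0 * (x * unit_gauss x).

(** Near the origin this is a Taylor estimate, from two applications of the
    mean value theorem and from [1 - x^2 / 2 <= exp (- x^2 / 2) <= 1]; far away
    every term is bounded. *)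
Lemma gauss_remainder_bound phi : test_function phi ->
  exists2 K, 0 <= K & forall x, `|gauss_remainder phi x| <= K * (x ^+ 2 * (1 + x ^+ 2)^-1).
Proof.
move=> tphi; have [M M0 phiM] := test_function_bounded tphi.
have d0 x := test_function_derive 0 x tphi.
have d1 x := test_function_derive 1 x tphi.
have c2 : continuous (derive1n 2 phi).
  exact: is_derive_continuous (fun x => test_function_derive 2 x tphi).
have [C C0 phiC] := continuous_bound_segment c2 ler01.
pose a := `|phi 0|; pose b := `|derive1n 1 phi 0|.
have a0 : 0 <= a by exact: normr_ge0.
have b0 : 0 <= b by exact: normr_ge0.
exists (2 * (C + M + a + b)); first by rewrite mulr_ge0 ?addr_ge0.
move=> x; pose z := x ^+ 2; have z0 : 0 <= z by exact: sqr_ge0.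
have z1 : 0 < 1 + z by rewrite ltr_pwDl.
have g1 := unit_gauss_le1 x; have g2 : 1 - 1 / 2 * z <= unit_gauss x by exact: expR_ge1Dx.
have [x1|x1] := leP `|x| 1.
  have zle1 : z <= 1 by rewrite /z -(real_normK (num_real x)) exprn_ile1.
  have [c cx Ec] := mean_value_origin x d0.
  have [e ec Ee] := mean_value_origin c d1.
  have Cx : `|phi x - phi 0 - derive1n 1 phi 0 * x| <= C * z.
    have -> : phi x - phi 0 - derive1n 1 phi 0 * x = derive1n 2 phi e * (c * x).
      by rewrite Ec mulrA -Ee mulrBl.
    rewrite normrM; apply: ler_pM => //.
      by apply: phiC; apply: le_trans ec (le_trans cx x1).
    rewrite normrM /z -(real_normK (num_real x)) expr2.
    by rewrite ler_wpM2r.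
  have gz : `|1 - unit_gauss x| <= z by rewrite ger0_norm; lra.
  have -> : gauss_remainder phi x = (phi x - phi 0 - derive1n 1 phi 0 * x) +
      (phi 0 * (1 - unit_gauss x) + derive1n 1 phi 0 * (x * (1 - unit_gauss x))).
    by rewrite /gauss_remainder; ring.
  apply: (@le_trans _ _ (C * z + (a * z + b * z))).
    apply: (le_trans (ler_normD _ _)); apply: lerD => //.
    apply: (le_trans (ler_normD _ _)); apply: lerD.
      by rewrite normrM ler_wpM2l.
    rewrite normrM ler_wpM2l// normrM -[leRHS]mul1r.
    exact: ler_pM.
  rewrite [leRHS]mulrA ler_pdivlMr//.
  have H : 0 <= (C + a + b) * z by rewrite mulr_ge0 ?addr_ge0.
  have H2 : (C + a + b) * z * (1 + z) <= (C + a + b) * z * 2.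
    by rewrite ler_wpM2l//; lra.
  have H3 : 0 <= M * z by rewrite mulr_ge0.
  by rewrite -/z; lra.
have zge1 : 1 <= z by rewrite /z -(real_normK (num_real x)) exprn_ege1// ltW.
apply: (@le_trans _ _ (M + (a + b))).
  rewrite /gauss_remainder -addrA; apply: (le_trans (ler_normD _ _)); apply: lerD => //.
  apply: (le_trans (ler_normD _ _)); rewrite !normrN; apply: lerD.
    by rewrite normrM ler_piMr// ger0_norm ?expR_ge0.
  by rewrite normrM ler_piMr// mulX_unit_gauss_le1.
rewrite [leRHS]mulrA ler_pdivlMr// -/z.
have H : (M + (a + b)) * 1 <= (M + (a + b)) * z by rewrite ler_wpM2l ?addr_ge0.
have H3 : 0 <= C * z by rewrite mulr_ge0.
lra.
Qed.

End test_functions.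

Section initial_dirac.
Context {R : realType}.
Notation mu := (@lebesgue_measure R).
Implicit Types (x y t : R).

Lemma integrable_mul_bounded (f g : R -> R) M : integrableT f -> continuous g ->
  (forall x, `|g x| <= M) -> integrableT (fun x => f x * g x).
Proof.
move=> fi cg gM.
apply: (integrable_dominated _ (integrable_mulrl M (integrable_norm fi))).
  apply: measurable_funM; first exact: integrable_measurable.
  exact: continuous_measurable_fun.
by move=> x; rewrite normrM mulrC ler_wpM2r.
Qed.

Lemma continuous_q t : 0 < t -> continuous (fun x => q x t).
Proof.
move=> t0 x; apply: differentiable_continuous; apply/derivable1_diffP.
exact: (@derivable_derive1n_q R 0 t x t0).
Qed.

Lemma q_bound t x : 0 < t ->
  `|q x t| <= (2 * pi)^-1 * integralT (quartic_symbol t).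
Proof.
move=> t0; have pi2 : 0 < (2 * pi)^-1 :> R by rewrite invr_gt0 mulr_gt0 ?pi_gt0.
have isym := integrable_symbol t0.
have ic := integrable_cos_symbol t0 x.
rewrite q_fourier// normrM (gtr0_norm pi2) ler_wpM2l ?(ltW pi2)//.
apply: (le_trans (le_normr_Rintegral measurableT ic)).
apply: le_Rintegral => //; first exact: integrable_norm.
by move=> y _; rewrite normrM (ger0_norm (symbol_ge0 _ _)) ler_piMl ?symbol_ge0 ?cos_max.
Qed.

(** [q] is bounded, and so is [x^2 q]. *)
Lemma integrable_q t : 0 < t -> integrableT (fun x => q x t).
Proof.
move=> t0; pose C := (2 * pi)^-1 * integralT (quartic_symbol t) +
  (2 * pi)^-1 * integralT (fun y => `|symbol_dd t y|).
apply: (integrable_dominated _ (integrable_mulrl C integrable_cauchy)).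
  exact: continuous_measurable_fun (continuous_q t0).
move=> x; rewrite ler_pdivlMr ?ltr_pwDl ?sqr_ge0// mulrDr mulr1.
by apply: lerD; [exact: q_bound|rewrite mulrC; exact: q_sqr_bound].
Qed.

Lemma q_even t x : q (- x) t = q x t.
Proof. by rewrite /q sqrrN. Qed.

(** Fubini: integrating first in [x] replaces [cos (x y)] by the Fourier
    transform of the Gaussian. *)
Lemma integral_q_gauss t : 0 < t ->
  integralT (fun x => q x t * unit_gauss x) =
  (2 * pi)^-1 * Num.sqrt (2 * pi) *
    integralT (fun y => quartic_symbol t y * unit_gauss y).
Proof.
move=> t0.
have ig : integrableT (@unit_gauss R) by apply: integrable_gauss.
have isym := integrable_symbol t0.
have isg : integrableT (fun y => quartic_symbol t y * unit_gauss y).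
  apply: (integrable_mul_bounded (M := 1) isym (@continuous_unit_gauss R)) => y.
  by rewrite ger0_norm ?expR_ge0// unit_gauss_le1.
have mg : measurable_fun setT (@unit_gauss R).
  exact: continuous_measurable_fun (@continuous_unit_gauss R).
have iqg : integrableT (fun x => q x t * unit_gauss x).
  apply: (integrable_mul_bounded (M := 1) (integrable_q t0)
    (@continuous_unit_gauss R)) => x.
  by rewrite ger0_norm ?expR_ge0// unit_gauss_le1.
have pi2 : 2 * pi != 0 :> R by rewrite gt_eqF// mulr_gt0 ?pi_gt0.
pose h x y := unit_gauss x * (cos (x * y) * quartic_symbol t y).
have hx x : integralT (h x) = 2 * pi * (q x t * unit_gauss x).
  rewrite /h RintegralZl//; last exact: integrable_cos_symbol.
  by rewrite q_fourier// -[(2 * pi)^-1 * _ * _]mulrA mulVKf// mulrC.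
have hy y : integralT (h ^~ y) = Num.sqrt (2 * pi) * (quartic_symbol t y * unit_gauss y).
  have := @gauss_cos_transform R 1 y ltr01; rewrite divr1 mulr1 => H.
  transitivity (integralT (fun x => quartic_symbol t y *
      (expR (- (1 / 2 * x ^+ 2)) * cos (y * x)))).
    by apply: eq_Rintegral => x _; rewrite /h /unit_gauss (mulrC x y); ring.
  rewrite RintegralZl//; last first.
    apply: (integrable_mul_bounded (M := 1) ig); first by smooth.
    by move=> x; exact: cos_max.
  rewrite H mulrCA /unit_gauss; congr (_ * (_ * expR (- _))).
  by field.
apply: (mulfI pi2); transitivity (integralT (fun x => integralT (h x))).
  by rewrite -RintegralZl//; apply: eq_Rintegral => x _; rewrite hx.
transitivity (integralT (fun y => integralT (h ^~ y))); last first.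
  rewrite -[in RHS]mulrA mulVKf// -RintegralZl//.
  by apply: eq_Rintegral => y _; rewrite hy.
apply: (@fubini_dominated R h (@unit_gauss R) (quartic_symbol t)).
- apply: measurable_funM; first exact: (measurableT_comp mg measurable_fst).
  apply: measurable_funM.
    apply: measurableT_comp; first exact: continuous_measurable_fun (@continuous_cos R).
    by apply: measurable_funM; [exact: measurable_fst|exact: measurable_snd].
  apply: (measurableT_comp _ measurable_snd).
  exact: continuous_measurable_fun (@continuous_symbol R t).
- exact: ig.
- exact: isym.
- move=> x y; rewrite /h normrM (ger0_norm (expR_ge0 _)) ler_wpM2l ?expR_ge0//.
  by rewrite normrM (ger0_norm (symbol_ge0 _ _)) ler_piMl ?symbol_ge0 ?cos_max.
Qed.

Lemma integral_q_odd t : 0 < t ->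
  integralT (fun x => q x t * (x * unit_gauss x)) = 0.
Proof.
move=> t0; pose f x := q x t * (x * unit_gauss x).
have fi : integrableT f.
  apply: (integrable_mul_bounded (M := 1) (integrable_q t0)).
    by rewrite /unit_gauss; smooth.
  exact: mulX_unit_gauss_le1.
have := integral_reflection fi.
have -> : integralT (fun x => f (- x)) = - integralT f.
  rewrite -[RHS]mulN1r -RintegralZl//; apply: eq_Rintegral => x _.
  by rewrite /f q_even /unit_gauss sqrrN; ring.
by rewrite -/f; lra.
Qed.

Lemma cvg_integral_q_gauss (u : nat -> R) :
  (forall n, 0 < u n) -> u n @[n --> \oo] --> 0 ->
  integralT (fun x => q x (u n) * unit_gauss x) @[n --> \oo] --> (1 : R).
Proof.
move=> u0 cu.
have pi2 : 0 < 2 * pi :> R by rewrite mulr_gt0 ?pi_gt0.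
have E1 : (2 * pi)^-1 * Num.sqrt (2 * pi) * integralT (@unit_gauss R) = 1.
  rewrite /unit_gauss integral_gauss// (_ : pi / (1 / 2) = 2 * pi); last by field.
  by rewrite -mulrA -expr2 sqr_sqrtr ?(ltW pi2)// mulVf ?gt_eqF.
rewrite -[X in _ --> X]E1; under eq_fun do rewrite integral_q_gauss//.
apply: cvgMl_tmp.
have mg : measurable_fun setT (@unit_gauss R).
  exact: continuous_measurable_fun (@continuous_unit_gauss R).
apply: (dominated_cvg_integral (g := @unit_gauss R)) => //.
- move=> n; apply: measurable_funM => //.
  exact: continuous_measurable_fun (@continuous_symbol R _).
- by apply: integrable_gauss.
- move=> y _; rewrite -[X in _ --> X]mul1r; apply: cvgM; last exact: cvg_cst.
  have c : continuous (fun t => quartic_symbol t y) by rewrite /quartic_symbol; smooth.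
  have := continuous_cvg _ (c 0) cu.
  by rewrite {2}/quartic_symbol !mul0r oppr0 expR0; apply.
- move=> n y _; rewrite ger0_norm ?mulr_ge0 ?expR_ge0// ler_piMl ?expR_ge0//.
  rewrite -[leRHS]expR0 ler_expR oppr_le0 mulr_ge0 ?divr_ge0 ?(ltW (u0 n))//.
  by rewrite exprn_even_ge0.
Qed.

Lemma integral_q_gauss_remainder t phi K : 0 < t -> 0 <= K ->
  continuous (gauss_remainder phi) ->
  (forall x, `|gauss_remainder phi x| <= K * (x ^+ 2 * (1 + x ^+ 2)^-1)) ->
  `|integralT (fun x => q x t * gauss_remainder phi x)| <=
  (2 * pi)^-1 * integralT (fun y => `|symbol_dd t y|) *
    (K * integralT (fun x => (1 + x ^+ 2)^-1)).
Proof.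
move=> t0 K0 cr rK.
set D := (2 * pi)^-1 * _.
have bnd x : `|q x t * gauss_remainder phi x| <= D * (K * (1 + x ^+ 2)^-1).
  have c0 : 0 <= (1 + x ^+ 2)^-1 :> R by rewrite invr_ge0 addr_ge0 ?sqr_ge0.
  rewrite normrM; apply: (le_trans (ler_wpM2l (normr_ge0 _) (rK x))).
  have := q_sqr_bound x t0; rewrite -/D => /(ler_wpM2r (mulr_ge0 K0 c0)).
  by congr (_ <= _); ring.
have ib : integrableT (fun x => D * (K * (1 + x ^+ 2)^-1)).
  by do 2 apply: integrable_mulrl; exact: integrable_cauchy.
have iqr : integrableT (fun x => q x t * gauss_remainder phi x).
  apply: (integrable_dominated _ ib bnd); apply: measurable_funM.
    exact: continuous_measurable_fun (continuous_q t0).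
  exact: continuous_measurable_fun.
apply: (le_trans (le_normr_Rintegral measurableT iqr)).
rewrite -RintegralZl//; last exact: integrable_cauchy.
rewrite -RintegralZl//; last by apply: integrable_mulrl; exact: integrable_cauchy.
by apply: le_Rintegral => //; exact: integrable_norm.
Qed.

Lemma cvg_integral_q_test (u : nat -> R) phi :
  (forall n, 0 < u n <= 1) -> u n @[n --> \oo] --> 0 -> test_function phi ->
  integralT (fun x => q x (u n) * phi x) @[n --> \oo] --> phi 0.
Proof.
move=> u01 cu tphi; have u0 n : 0 < u n by have /andP[] := u01 n.
have [K K0 rK] := gauss_remainder_bound tphi.
have cphi := test_function_continuous tphi.
have cr : continuous (gauss_remainder phi).
  move=> x; apply: cvgB; first apply: cvgB; first exact: cphi.
    by apply: cvgMl_tmp; exact: continuous_unit_gauss.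
  by apply: cvgMl_tmp; move: x; rewrite /unit_gauss; smooth.
have g1 x : `|unit_gauss x| <= 1 :> R by rewrite ger0_norm ?expR_ge0// unit_gauss_le1.
have cg := @continuous_unit_gauss R.
have cxg : continuous (fun x : R => x * unit_gauss x) by rewrite /unit_gauss; smooth.
have E n : integralT (fun x => q x (u n) * phi x) =
    phi 0 * integralT (fun x => q x (u n) * unit_gauss x) +
    integralT (fun x => q x (u n) * gauss_remainder phi x).
  have iq := integrable_q (u0 n).
  have i1 := integrable_mul_bounded iq cg g1.
  have i2 := integrable_mul_bounded iq cxg (@mulX_unit_gauss_le1 R).
  have i3 : integrableT (fun x => q x (u n) * gauss_remainder phi x).
    apply: (integrable_mul_bounded (M := K) iq cr) => x; apply: (le_trans (rK x)).
    rewrite ler_piMr// ler_pdivrMr ?ltr_pwDl ?sqr_ge0// mul1r lerDr//.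
  have := integral_q_odd (u0 n) => odd0.
  transitivity (integralT (fun x => phi 0 * (q x (u n) * unit_gauss x) +
      (derive1n 1 phi 0 * (q x (u n) * (x * unit_gauss x)) +
       q x (u n) * gauss_remainder phi x))).
    by apply: eq_Rintegral => x _; rewrite /gauss_remainder; ring.
  rewrite RintegralD//; [|exact: integrable_mulrl|].
    rewrite RintegralD//; last exact: integrable_mulrl.
    by rewrite !RintegralZl// odd0 mulr0 add0r.
  by apply: integrable_addr => //; exact: integrable_mulrl.
rewrite -[X in _ --> X]addr0; under eq_fun do rewrite E.
apply: cvgD.
  rewrite -[X in _ --> X]mulr1; apply: cvgMl_tmp; exact: cvg_integral_q_gauss.
set A := K * integralT (fun x : R => (1 + x ^+ 2)^-1).
have cD : (2 * pi)^-1 * integralT (fun y => `|symbol_dd (u n) y|) * A @[n --> \oo] --> 0.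
  rewrite -(mul0r A); apply: cvgMr_tmp; rewrite -(mulr0 (2 * pi)^-1).
  by apply: cvgMl_tmp; exact: cvg_integral_symbol_dd.
apply/norm_cvg0P; apply: (squeeze_cvgr _ (cvg_cst 0) cD).
by apply: nearW => n; rewrite normr_ge0/=; exact: integral_q_gauss_remainder.
Qed.

Lemma q_initial_dirac : initial_dirac (@q R).
Proof.
split=> [t t0|phi tphi].
  apply: open_integrable_locally; first exact: openT.
  exact: integrable_q.
apply/cvg_at_rightP => u [u0 cu].
have [N _ uN] : \forall n \near \oo, u n <= 1.
  by near do apply: ltW; apply: (cvgr_lt (0 : R)) => //.
(* only the times at most 1 matter, where symbol_dd_bound applies *)
rewrite -(cvg_shiftn N); apply: cvg_integral_q_test => //.
  by move=> n; rewrite u0/= uN//= leq_addl.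
by rewrite (cvg_shiftn N u).
Unshelve. all: end_near. Qed.

End initial_dirac.

Theorem theorem6p1 (R : realType) (d : measure_display) (T : measurableType d)
    (P : probability T R) (B : R -> {RV P >-> R})
    (hB : standard_brownian_motion B) :
  [/\ has_composition_density B (@q R),
      fourth_order_heat_eq (@q R)
    & initial_dirac (@q R)].
Proof.
split; [|exact: q_heat_eq|exact: q_initial_dirac].
by move=> x t t0; exact: integral_abs_law_fresnel.
Qed.
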